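(* Let $n>1$ be an odd integer and let $M$ be either $(n+1)/2$ or $n-1$. Then, modulo $\Phi_n(q)(1-aq^n)(a-q^n)$, \begin{align*} &\sum_{k=0}^{M}[4k-1]\frac{(aq^{-1},q^{-1}/a,q^{-1}/b,cq^{-1},dq^{-1},q^{-1};q^2)_k}{(q^{2}/a,aq^2,bq^2,q^2/c,q^{2}/d,q^2;q^2)_k}\bigg(\frac{bq^7}{cd}\bigg)^k\\ &\equiv[n](bq)^{(n+1)/2}\frac{(q^{-2}/b;q^2)_{(n+1)/2}}{(bq^2;q^2)_{(n+1)/2}} \sum_{k=0}^{(n+1)/2}\frac{(aq^{-1},q^{-1}/a,q^{-1}/b,q^3/cd;q^2)_k}{(q^2,q^{-2}/b,q^2/c,q^2/d;q^2)_k}q^{2k}. \end{align*}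
   Context: Here $q,a,b,c,d$ are indeterminates. The $q$-shifted factorial is $(x;q)_0=1$, $(x;q)_k=(1-x)(1-xq)\cdots(1-xq^{k-1})$ for $k\ge1$, and $(x_1,\dots,x_m;q)_k=(x_1;q)_k\cdots(x_m;q)_k$. The $q$-integer is $[m]=(1-q^m)/(1-q)$, and $\Phi_n(q)$ is the $n$-th cyclotomic polynomial in $q$. A congruence $A\equiv B$ modulo a polynomial $P$ between rational functions means that $A-B$ is a rational function whose numerator is divisible by $P$ and whose denominator is coprime to $P$. *)

(* Defs.v *)
From HB Require Import structures.
From mathcomp Require Import all_boot all_order all_algebra all_field.
From mathcomp Require Import mpoly.
Set Implicit Arguments. Unset Strict Implicit. Unset Printing Implicit Defensive.
Import Order.TTheory GRing.Theory Num.Theory.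
Local Open Scope ring_scope.

Definition Pol := {mpoly rat[5]}.
Definition Frac := {fraction Pol}.

Definition Xq : Pol := 'X_(inord 0).
Definition Xa : Pol := 'X_(inord 1).
Definition Xb : Pol := 'X_(inord 2).
Definition Xc : Pol := 'X_(inord 3).
Definition Xd : Pol := 'X_(inord 4).

Definition tof (p : Pol) : Frac := @FracField.tofrac _ p.
Local Notation "x %:F" := (tof x).

Definition q : Frac := Xq%:F.
Definition a : Frac := Xa%:F.
Definition b : Frac := Xb%:F.
Definition c : Frac := Xc%:F.
Definition d : Frac := Xd%:F.

Definition qpoch (x p : Frac) (k : nat) : Frac := \prod_(i < k) (1 - x * p ^+ i).

Definition qint (m : int) : Frac := (1 - q ^ m) / (1 - q).

Definition PhiQ (n : nat) : Pol := (map_poly (fun z : int => z%:~R) 'Phi_n).[Xq].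

Definition mdvd (g p : Pol) : Prop := exists h : Pol, p = g * h.
Definition mcoprime (D P : Pol) : Prop :=
  forall g : Pol, mdvd g D -> mdvd g P -> exists r : rat, r != 0 /\ g = r%:MP.

Definition congr_mod (A B : Frac) (P : Pol) : Prop :=
  exists N D : Pol, D != 0 /\ mcoprime D P /\ A - B = (N * P)%:F / D%:F.

Definition modulus (n : nat) : Pol := PhiQ n * (1 - Xa * Xq ^+ n) * (Xa - Xq ^+ n).

Definition lhs (M : nat) : Frac :=
  \sum_(0 <= k < M.+1)
    qint ((4 * k)%N%:Z - 1) *
    (qpoch (a / q) (q ^+ 2) k * qpoch (q^-1 / a) (q ^+ 2) k * qpoch (q^-1 / b) (q ^+ 2) k *
     qpoch (c / q) (q ^+ 2) k * qpoch (d / q) (q ^+ 2) k * qpoch (q^-1) (q ^+ 2) k) /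
    (qpoch (q ^+ 2 / a) (q ^+ 2) k * qpoch (a * q ^+ 2) (q ^+ 2) k * qpoch (b * q ^+ 2) (q ^+ 2) k *
     qpoch (q ^+ 2 / c) (q ^+ 2) k * qpoch (q ^+ 2 / d) (q ^+ 2) k * qpoch (q ^+ 2) (q ^+ 2) k) *
    (b * q ^+ 7 / (c * d)) ^+ k.

Definition rhs (n : nat) : Frac :=
  let m := ((n + 1) %/ 2)%N in
  qint n%:Z * (b * q) ^+ m * qpoch ((q ^+ 2)^-1 / b) (q ^+ 2) m / qpoch (b * q ^+ 2) (q ^+ 2) m *
  \sum_(0 <= k < m.+1)
    (qpoch (a / q) (q ^+ 2) k * qpoch (q^-1 / a) (q ^+ 2) k * qpoch (q^-1 / b) (q ^+ 2) k *
     qpoch (q ^+ 3 / (c * d)) (q ^+ 2) k) /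
    (qpoch (q ^+ 2) (q ^+ 2) k * qpoch ((q ^+ 2)^-1 / b) (q ^+ 2) k * qpoch (q ^+ 2 / c) (q ^+ 2) k *
     qpoch (q ^+ 2 / d) (q ^+ 2) k) * q ^+ (2 * k)%N.

(* Main.v *)
Require Import Defs.
From HB Require Import structures.
From mathcomp Require Import all_boot all_order all_algebra all_field.
From mathcomp Require Import mpoly.
From mathcomp Require Import ring.
Set Implicit Arguments. Unset Strict Implicit. Unset Printing Implicit Defensive.
Import Order.TTheory GRing.Theory Num.Theory.
Local Open Scope ring_scope.

(** Each of the three factors of the modulus generates the kernel of a ring
morphism from the polynomials to a field: [q] goes to a primitive [n]-th root of
unity for [Phi_n(q)], [a] goes to [q ^- n] for [1 - a q ^+ n], and [a] goes to
[q ^+ n] for [a - q ^+ n]. A denominator that none of these morphisms kills is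
regular, hence coprime, modulo the product, so the congruence follows once both
sides have the same image under each morphism.

With [a = q ^- n] or [a = q ^+ n] the left-hand sum stops at [m = (n + 1) / 2]
and the equality of the two sides is an instance of Watson's transformation of a
terminating very-well-poised 8phi7 series into a balanced 4phi3 series. With [q]
a root of unity the factor [[n]] kills the right-hand side, while on the left
the terms of index [k] and [m - k] are opposite and those of index greater than
[m] vanish. *)

(** * Watson's transformation *)

Ltac field_nz := field; rewrite ?oner_eq0 //; by do ?[apply/andP; split].

(** Stated over any field, with the body of [qpoch], so that one set of identities serves both the
    indeterminates and their images. *)
Definition poch (F : fieldType) (x p : F) (k : nat) : F := \prod_(i < k) (1 - x * p ^+ i).

Section Hypergeometric.
Variable F : fieldType.
Implicit Types q a b c d e x p : F.

Lemma poch0 x p : poch x p 0 = 1.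
Proof. by rewrite /poch big_ord0. Qed.

Lemma pochS x p k : poch x p k.+1 = poch x p k * (1 - x * p ^+ k).
Proof. by rewrite /poch big_ord_recr. Qed.

Lemma pochSl x p k : poch x p k.+1 = (1 - x) * poch (x * p) p k.
Proof.
rewrite /poch big_ord_recl expr0 mulr1; congr (_ * _).
by apply: eq_bigr => i _; rewrite /= exprS mulrA.
Qed.

Lemma poch_add x p j k : poch x p (j + k) = poch x p j * poch (x * p ^+ j) p k.
Proof.
rewrite /poch big_split_ord /=; congr (_ * _).
by apply: eq_bigr => i _; rewrite exprD mulrA.
Qed.

Lemma poch_neq0 x p k : (forall i, (i < k)%N -> 1 - x * p ^+ i != 0) -> poch x p k != 0.
Proof. by move=> H; apply/prodf_neq0 => i _; apply: H. Qed.

Lemma poch_eq0 x p i k : (i < k)%N -> 1 - x * p ^+ i = 0 -> poch x p k = 0.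
Proof.
by move=> ik H; apply/eqP/prodf_eq0; exists (Ordinal ik) => //=; rewrite H.
Qed.

Lemma sub_div_neq0 x y z : y != 0 -> 1 - x / y * z != 0 -> y - x * z != 0.
Proof.
move=> y0; apply: contraNneq => h.
have -> : 1 - x / y * z = (y - x * z) / y by field.
by rewrite h mul0r.
Qed.

(** This is [q ^+ N ^+ k] times the shifted factorial of [q ^- N], kept free of division. It
    vanishes for [k > N] and so makes the series below terminate. *)
Definition qdesc q N k : F := \prod_(i < k) (q ^+ N - q ^+ i).

Lemma qdescS q N k : qdesc q N k.+1 = qdesc q N k * (q ^+ N - q ^+ k).
Proof. by rewrite /qdesc big_ord_recr. Qed.

Lemma qdescSl q N k : qdesc q N.+1 k.+1 = (q ^+ N.+1 - 1) * q ^+ k * qdesc q N k.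
Proof.
rewrite /qdesc big_ord_recl expr0 -mulrA; congr (_ * _).
elim: k => [|k IH]; first by rewrite !big_ord0 expr0 mulr1.
rewrite !big_ord_recr /= IH /bump /= !exprS.
ring.
Qed.

Lemma qdesc_eq0 q N k : (N < k)%N -> qdesc q N k = 0.
Proof.
by move=> ik; apply/eqP/prodf_eq0; exists (Ordinal ik) => //=; rewrite subrr.
Qed.

(** The summand of the terminating very-well-poised 6phi5 series in [b], [c] and [q ^- N],
    multiplied by [1 - a]. The power [q ^+ (N * k)] of its argument is hidden in [qdesc]. *)
Definition vwp_term q a b c N k : F :=
  poch a q k * (1 - a * q ^+ (2 * k)) * poch b q k * poch c q k /
  (poch q q k * poch (a * q / b) q k * poch (a * q / c) q k) *
  (a * q / (b * c)) ^+ k * (qdesc q N k / poch (a * q ^+ N.+1) q k).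

(* The right-hand side of the telescoping relation is the WZ mate of the
   very-well-poised summand. *)
Lemma vwp_telescope q a b c N m :
  b != 0 -> c != 0 -> (forall i, 1 - q ^+ i.+1 != 0) ->
  (forall i, 1 - a * q ^+ i.+1 != 0) ->
  (forall i, 1 - a * q / b * q ^+ i != 0) ->
  (forall i, 1 - a * q / c * q ^+ i != 0) ->
  \sum_(k < m.+1) (vwp_term q a b c N.+1 k -
    (1 - a * q ^+ N.+1) * (1 - a * q / (b * c) * q ^+ N) /
    ((1 - a * q / b * q ^+ N) * (1 - a * q / c * q ^+ N)) * vwp_term q a b c N k) =
  q ^+ N * (1 - a * q ^+ N.+1) / ((1 - a * q / b * q ^+ N) * (1 - a * q / c * q ^+ N)) *
  (poch a q m.+1 * poch b q m.+1 * poch c q m.+1 /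
   (poch q q m * poch (a * q / b) q m * poch (a * q / c) q m) *
  (a * q / (b * c)) ^+ m.+1 * (qdesc q N m / poch (a * q ^+ N.+1) q m.+1)).
Proof.
move=> b0 c0 hq ha hb hc.
have aN : 1 - a * q ^+ N.+1 != 0 by [].
have bN := hb N; have cN := hc N.
elim: m => [|m IH].
  rewrite big_ord_recl big_ord0 /vwp_term !pochS !poch0 /qdesc !big_ord0 /=.
  rewrite !expr0 !exprS in aN bN cN *.
  move: (q ^+ N) aN bN cN => Q aN bN cN.
  have bN' := sub_div_neq0 b0 bN; have cN' := sub_div_neq0 c0 cN.
  by field; rewrite b0 c0 bN' cN' aN oner_eq0.
rewrite big_ord_recr {}IH /= /vwp_term qdescSl qdescS.
(* Everything is brought to the base [a * q ^+ N.+1], so that both summands and the boundary term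
   share their factors. *)
have -> : poch (a * q ^+ N.+2) q m.+1 =
    poch (a * q ^+ N.+1) q m.+1 * (1 - a * q ^+ N.+1 * q ^+ m.+1) / (1 - a * q ^+ N.+1).
  by rewrite -pochS (pochSl _ _ m.+1) -(mulrA a) -exprSr mulrAC divff // mul1r.
have VN : poch (a * q ^+ N.+1) q m.+1 != 0.
  by apply: poch_neq0 => i _; rewrite -mulrA -exprD addSn.
have VN' : 1 - a * q ^+ N.+1 * q ^+ m.+1 != 0 by rewrite -mulrA -exprD addSn.
have qm : poch q q m != 0 by apply: poch_neq0 => i _; rewrite -exprS.
have bm : poch (a * q / b) q m != 0 by apply: poch_neq0.
have cm : poch (a * q / c) q m != 0 by apply: poch_neq0.
have bm' := sub_div_neq0 b0 (hb m); have cm' := sub_div_neq0 c0 (hc m).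
have bN' := sub_div_neq0 b0 bN; have cN' := sub_div_neq0 c0 cN.
have qm' : 1 - q ^+ m.+1 != 0 by [].
rewrite !(pochS _ _ m.+1) !(pochS q q m) !(pochS (a * q / b) q m) !(pochS (a * q / c) q m).
move: (poch a q m.+1) (poch b q m.+1) (poch c q m.+1) (qdesc q N m) => Pa Pb Pc D.
move: (poch (a * q ^+ N.+1) q m.+1) VN => V VN.
move: (poch q q m) (poch (a * q / b) q m) (poch (a * q / c) q m) qm bm cm.
move=> Pq Pab Pac qm bm cm.
rewrite mul2n -addnn exprD !(exprS _ m.+1) !(exprS _ m) !(exprS _ N) in aN VN' qm' *.
move: ((a * q / (b * c)) ^+ m) => X.
move: (q ^+ N) (q ^+ m) aN VN' qm' bm' cm' bN' cN' => Q K aN VN' qm' bm' cm' bN' cN'.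
by field; rewrite VN' VN c0 b0 cm' cm bm' bm qm' qm cN' bN' aN.
Qed.

(* Rogers' terminating 6phi5 sum. *)
Lemma vwp_sum q a b c N :
  b != 0 -> c != 0 -> (forall i, 1 - q ^+ i.+1 != 0) ->
  (forall i, 1 - a * q ^+ i.+1 != 0) ->
  (forall i, 1 - a * q / b * q ^+ i != 0) ->
  (forall i, 1 - a * q / c * q ^+ i != 0) ->
  \sum_(k < N.+1) vwp_term q a b c N k =
  poch a q N.+1 * poch (a * q / (b * c)) q N /
  (poch (a * q / b) q N * poch (a * q / c) q N).
Proof.
move=> b0 c0 hq ha hb hc; elim: N => [|N IH].
  rewrite big_ord_recl big_ord0 /vwp_term /qdesc big_ord0 pochS !poch0 !muln0 !expr0.
  by rewrite !mulr1 !invr1 addr0 !mulr1 mul1r.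
(* With [m = N + 1] the boundary term contains [qdesc q N N.+1 = 0], so the telescoping relation
   becomes a first-order recurrence in [N]. *)
have := vwp_telescope N N.+1 b0 c0 hq ha hb hc.
rewrite (qdesc_eq0 _ (ltnSn N)) mul0r !mulr0 sumrB -mulr_sumr => /eqP.
rewrite subr_eq0 => /eqP ->.
rewrite big_ord_recr /= {2}/vwp_term (qdesc_eq0 _ (ltnSn N)) mul0r mulr0 addr0 {}IH.
rewrite (pochS _ _ N.+1) !(pochS _ _ N).
have := poch_neq0 (fun i (_ : (i < N)%N) => hb i).
have := poch_neq0 (fun i (_ : (i < N)%N) => hc i).
move: (poch _ _ N) (poch _ _ N) (poch _ _ N) (poch a q N) => Pc Pb Pbc Pa c1 b1.
have bN' := sub_div_neq0 b0 (hb N); have cN' := sub_div_neq0 c0 (hc N).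
by field; rewrite c1 b1 bN' cN' b0 c0.
Qed.

(** The summand of the terminating balanced 3phi2 series with upper parameters [a * q / (b * c)],
    [a * q ^+ k], [q ^- k] and lower parameters [a * q / b], [a * q / c]. *)
Definition saal_term q a b c k j : F :=
  poch (a * q / (b * c)) q j * q ^+ j /
  (poch q q j * poch (a * q / b) q j * poch (a * q / c) q j) *
  (poch (a * q ^+ k) q j * qdesc q k j / q ^+ k ^+ j).

(** A second WZ pair, now in [k]. At [m = k + 1] the right-hand side vanishes and a first-order
    recurrence for the 3phi2 sum remains. *)
Lemma saal_telescope q a b c k m :
  q != 0 -> b != 0 -> c != 0 -> (forall i, 1 - q ^+ i.+1 != 0) ->
  (forall i, 1 - a * q / b * q ^+ i != 0) ->
  (forall i, 1 - a * q / c * q ^+ i != 0) ->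
  \sum_(j < m.+1) (saal_term q a b c k.+1 j -
    (1 - b * q ^+ k) * (1 - c * q ^+ k) * (a * q / (b * c)) /
    ((1 - a * q / b * q ^+ k) * (1 - a * q / c * q ^+ k)) * saal_term q a b c k j) =
  (1 - a * q * q ^+ k * q ^+ k) / ((1 - a * q / b * q ^+ k) * (1 - a * q / c * q ^+ k)) *
  (poch (a * q / (b * c)) q m.+1 /
   (poch q q m * poch (a * q / b) q m * poch (a * q / c) q m) *
   (poch (a * q ^+ k.+1) q m * qdesc q k m / q ^+ k ^+ m)).
Proof.
move=> q0 b0 c0 hq hb hc.
have bN' := sub_div_neq0 b0 (hb k); have cN' := sub_div_neq0 c0 (hc k).
elim: m => [|m IH].
  rewrite big_ord_recl big_ord0 /saal_term !pochS !poch0 /qdesc !big_ord0 /=.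
  rewrite !expr0.
  move: (q ^+ k) bN' cN' => Q bN' cN'.
  by field; rewrite b0 c0 bN' cN' oner_eq0.
rewrite big_ord_recr {}IH /= /saal_term qdescSl qdescS.
rewrite (pochSl (a * q ^+ k)) -(mulrA a (q ^+ k)) -exprSr.
have qm : poch q q m != 0 by apply: poch_neq0 => i _; rewrite -exprS.
have bm : poch (a * q / b) q m != 0 by apply: poch_neq0.
have cm : poch (a * q / c) q m != 0 by apply: poch_neq0.
have bm' := sub_div_neq0 b0 (hb m); have cm' := sub_div_neq0 c0 (hc m).
have qm' : 1 - q ^+ m.+1 != 0 by [].
rewrite !(pochS _ _ m.+1) !(pochS _ _ m).
move: (poch (a * q / (b * c)) q m) (poch (a * q ^+ k.+1) q m) (qdesc q k m) => Pa Pb D.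
move: (poch q q m) (poch (a * q / b) q m) (poch (a * q / c) q m) qm bm cm => Pq Pab Pac qm bm cm.
rewrite !(exprS _ m) !(exprS _ k) (exprMn m) in qm' *.
move: (q ^+ k) (q ^+ m) (expf_neq0 k q0) (expf_neq0 m q0) qm' bm' cm' bN' cN'
  => Q K Q0 K0 qm' bm' cm' bN' cN'.
move: (Q ^+ m) (expf_neq0 m Q0) => X X0.
by field; rewrite X0 Q0 c0 b0 cm' cm bm' bm qm' qm cN' bN' K0 q0.
Qed.

(* The q-Pfaff-Saalschuetz sum, read as an expansion of the [k]-th ratio. *)
Lemma saal_sum q a b c k :
  q != 0 -> b != 0 -> c != 0 -> (forall i, 1 - q ^+ i.+1 != 0) ->
  (forall i, 1 - a * q / b * q ^+ i != 0) ->
  (forall i, 1 - a * q / c * q ^+ i != 0) ->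
  \sum_(j < k.+1) saal_term q a b c k j =
  poch b q k * poch c q k / (poch (a * q / b) q k * poch (a * q / c) q k) *
  (a * q / (b * c)) ^+ k.
Proof.
move=> q0 b0 c0 hq hb hc; elim: k => [|k IH].
  rewrite big_ord_recl big_ord0 /saal_term /qdesc big_ord0 !poch0 !expr0.
  by rewrite !mulr1 !invr1 addr0 !mulr1.
have := saal_telescope k k.+1 q0 b0 c0 hq hb hc.
rewrite (qdesc_eq0 _ (ltnSn k)) mulr0 mul0r !mulr0 sumrB -mulr_sumr => /eqP.
rewrite subr_eq0 => /eqP ->.
rewrite big_ord_recr /= {2}/saal_term (qdesc_eq0 _ (ltnSn k)) mulr0 mul0r mulr0 addr0 {}IH.
rewrite !(pochS _ _ k) exprS.
have := poch_neq0 (fun i (_ : (i < k)%N) => hb i).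
have := poch_neq0 (fun i (_ : (i < k)%N) => hc i).
have bN' := sub_div_neq0 b0 (hb k); have cN' := sub_div_neq0 c0 (hc k).
move: ((a * q / (b * c)) ^+ k) (poch _ _ k) (poch _ _ k) (poch c q k) (poch b q k) => X Pc Pb Pbc Pa c1 b1.
by field; rewrite c1 b1 bN' cN' b0 c0.
Qed.

(** With [N = j + l], each factor [q ^+ N - q ^+ i] is [- q ^+ i * (1 - q ^+ (N - i))]. *)
Lemma qdesc_poch q l j :
  qdesc q (j + l) j * poch q q l = poch q q (j + l) * \prod_(i < j) (- q ^+ i).
Proof.
elim: j => [|j IH]; first by rewrite /qdesc !big_ord0 mulr1 mul1r.
rewrite addSn qdescSl big_ord_recr pochS /= -mulrA IH -exprS; ring.
Qed.

Lemma qdesc_add q j M l :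
  qdesc q (j + M) (j + l) = qdesc q (j + M) j * (q ^+ j ^+ l * qdesc q M l).
Proof.
rewrite {1 2}/qdesc big_split_ord /=; congr (_ * _).
elim: l => [|l IH]; first by rewrite /qdesc !big_ord0 expr0 mulr1.
rewrite big_ord_recr IH qdescS /= exprS !exprD; ring.
Qed.

(** The inner sum of Watson's transformation once the sums are exchanged. Its terms start at
    [k = j], and with [k = j + l] it is a multiple of the 6phi5 sum of length [M] in which [a], [d],
    [e] are replaced by [a * q ^+ (2 * j)], [d * q ^+ j], [e * q ^+ j]. *)
Lemma vwp_saal_sum q a d e j M :
  q != 0 -> d != 0 -> e != 0 -> (forall i, 1 - q ^+ i.+1 != 0) ->
  (forall i, 1 - a * q ^+ i.+1 != 0) ->
  (forall i, 1 - a * q / d * q ^+ i != 0) ->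
  (forall i, 1 - a * q / e * q ^+ i != 0) ->
  \sum_(k < (j + M).+1) vwp_term q a d e (j + M) k *
     (poch (a * q ^+ k) q j * qdesc q k j / q ^+ k ^+ j) =
  poch a q (j + M).+1 * poch (a * q / (d * e)) q M /
  (poch (a * q / d) q (j + M) * poch (a * q / e) q (j + M)) *
  (poch d q j * poch e q j * (a * q / (d * e)) ^+ j * qdesc q (j + M) j *
   (\prod_(i < j) - q ^+ i) / q ^+ j ^+ j).
Proof.
move=> q0 d0 e0 hq ha hd he.
rewrite -addnS big_split_ord /= big1 ?add0r => [|i _]; last first.
  by rewrite (qdesc_eq0 _ (ltn_ord i)) mulr0 mul0r mulr0.
have qj0 : q ^+ j != 0 by rewrite expf_neq0.
have hd' i : 1 - a * q ^+ (2 * j) * q / (d * q ^+ j) * q ^+ i != 0.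
  have := hd (j + i)%N; rewrite exprD; congr (_ != 0).
  by rewrite mul2n -addnn exprD; field; rewrite d0 qj0.
have he' i : 1 - a * q ^+ (2 * j) * q / (e * q ^+ j) * q ^+ i != 0.
  have := he (j + i)%N; rewrite exprD; congr (_ != 0).
  by rewrite mul2n -addnn exprD; field; rewrite e0 qj0.
have ha' i : 1 - a * q ^+ (2 * j) * q ^+ i.+1 != 0 by rewrite -mulrA -exprD addnS.
have VN k : poch (a * q ^+ (j + M).+1) q k != 0.
  by apply: poch_neq0 => i _; rewrite -mulrA -exprD addSn.
have VN' k : poch (a * q ^+ (2 * j) * q ^+ M.+1) q k != 0.
  by apply: poch_neq0 => i _; rewrite -!mulrA -!exprD !addSn !addnS.
have Pq k : poch q q k != 0 by apply: poch_neq0 => i _; rewrite -exprS.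
have Pd k : poch (a * q / d) q k != 0 by apply: poch_neq0.
have Pe k : poch (a * q / e) q k != 0 by apply: poch_neq0.
have Ed : a * q ^+ (2 * j) * q / (d * q ^+ j) = a * q / d * q ^+ j.
  by rewrite mul2n -addnn exprD; field; rewrite d0 qj0.
have Ee : a * q ^+ (2 * j) * q / (e * q ^+ j) = a * q / e * q ^+ j.
  by rewrite mul2n -addnn exprD; field; rewrite e0 qj0.
have Ede : a * q ^+ (2 * j) * q / (d * q ^+ j * (e * q ^+ j)) = a * q / (d * e).
  by rewrite mul2n -addnn exprD; field; rewrite e0 d0 qj0.
have := vwp_sum M (mulf_neq0 d0 qj0) (mulf_neq0 e0 qj0) hq ha' hd' he'.
rewrite Ed Ee Ede => S.
(* The ratio, independent of [l], between the summand at [k = j + l] and the shifted 6phi5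
   summand. *)
set C := poch a q (2 * j) * poch d q j * poch e q j /
    (poch (a * q / d) q j * poch (a * q / e) q j) *
    (a * q / (d * e)) ^+ j * qdesc q (j + M) j / poch (a * q ^+ (j + M).+1) q j *
    (\prod_(i < j) - q ^+ i) / q ^+ j ^+ j.
transitivity (C * \sum_(k < M.+1) vwp_term q (a * q ^+ (2 * j)) (d * q ^+ j) (e * q ^+ j) M k).
  rewrite mulr_sumr; apply: eq_bigr => l _; rewrite /vwp_term Ed Ee Ede {}/C.
  rewrite (poch_add d) (poch_add e) (poch_add (a * q / d)) (poch_add (a * q / e)).
  have Edd : poch (a * q / d * q ^+ j) q l != 0.
    by apply: poch_neq0 => i _; rewrite -mulrA -exprD.
  have Eee : poch (a * q / e * q ^+ j) q l != 0.
    by apply: poch_neq0 => i _; rewrite -mulrA -exprD.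
  (* Both products are the shifted factorial of [a] of length [2 * j + l]. *)
  have E1 : poch a q (j + l) * poch (a * q ^+ (j + l)) q j =
      poch a q (2 * j) * poch (a * q ^+ (2 * j)) q l.
    by rewrite -!poch_add addnAC mul2n addnn.
  have -> : qdesc q (j + l) j = poch q q (j + l) * (\prod_(i < j) - q ^+ i) / poch q q l.
    by rewrite -qdesc_poch mulfK.
  rewrite qdesc_add (poch_add (a * q ^+ (j + M).+1)).
  have -> : a * q ^+ (j + M).+1 * q ^+ j = a * q ^+ (2 * j) * q ^+ M.+1.
    by rewrite -!mulrA -!exprD addSn addnAC mul2n addnn addnS.
  have -> : a * q ^+ (2 * (j + l)) = a * q ^+ (2 * j) * q ^+ (2 * l).
    by rewrite mulnDr exprD mulrA.
  have -> : q ^+ (j + l) ^+ j = q ^+ j ^+ j * q ^+ j ^+ l.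
    by rewrite exprD exprMn (exprAC _ l j).
  rewrite (exprD (a * q / (d * e))).
  have nz1 := VN' l; have nz2 := VN j; have nz3 := Pq l; have nz4 := Pq (j + l)%N.
  have nz5 := Pd j; have nz6 := Pe j.
  have nz7 : q ^+ j ^+ l != 0 by rewrite expf_neq0.
  have nz8 : q ^+ j ^+ j != 0 by rewrite expf_neq0.
  move: nz1 nz2 nz3 nz4 nz5 nz6 nz7 nz8 Edd Eee E1.
  move: (q ^+ j ^+ l) (q ^+ j ^+ j) => Qjl Qjj.
  move: (poch (a * q ^+ (2 * j) * q ^+ M.+1) q l) (poch (a * q ^+ (j + M).+1) q j).
  move: (poch q q l) (poch q q (j + l)) (poch (a * q / d) q j) (poch (a * q / e) q j).
  move: (poch (a * q / d * q ^+ j) q l) (poch (a * q / e * q ^+ j) q l).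
  move: (poch a q (j + l)) (poch (a * q ^+ (j + l)) q j) (poch a q (2 * j)).
  move: (poch (a * q ^+ (2 * j)) q l) ((a * q / (d * e)) ^+ j) ((a * q / (d * e)) ^+ l).
  move: (1 - a * q ^+ (2 * j) * q ^+ (2 * l)) (qdesc q (j + M) j) (qdesc q M l).
  move: (poch d q j) (poch e q j) (poch (d * q ^+ j) q l) (poch (e * q ^+ j) q l).
  move: (\prod_(i < j) - q ^+ i).
  move=> t1 t2 t3 t4 t5 t6 t7 t8 t9 t10 t11 t12 t13 t14 t15 t16 t17 t18 t19 t20 t21 t22.
  move=> h1 h2 h3 h4 h5 h6 h7 h8 h9 h10 E1.
  by field: E1; rewrite h1 h2 h3 h4 h5 h6 h7 h8 h9 h10.
rewrite S {}/C.
have E1 : poch a q (2 * j) * poch (a * q ^+ (2 * j)) q M.+1 =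
    poch a q (j + M.+1) * poch (a * q ^+ (j + M).+1) q j.
  by rewrite -addnS -!poch_add addnAC mul2n addnn.
have Edd : poch (a * q / d * q ^+ j) q M != 0.
  by apply: poch_neq0 => i _; rewrite -mulrA -exprD.
have Eee : poch (a * q / e * q ^+ j) q M != 0.
  by apply: poch_neq0 => i _; rewrite -mulrA -exprD.
rewrite (poch_add (a * q / d)) (poch_add (a * q / e)).
have nz8 : q ^+ j ^+ j != 0 by rewrite expf_neq0.
move: (VN j) (Pd j) (Pe j) nz8 Edd Eee E1.
move: (poch a q (2 * j)) (poch (a * q ^+ (2 * j)) q M.+1) (poch a q (j + M.+1)).
move: (poch (a * q ^+ (j + M).+1) q j) (q ^+ j ^+ j) (\prod_(i < j) - q ^+ i).
move: (poch (a * q / d) q j) (poch (a * q / e) q j) ((a * q / (d * e)) ^+ j).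
move: (poch (a * q / d * q ^+ j) q M) (poch (a * q / e * q ^+ j) q M).
move=> t1 t2 t3 t4 t5 t6 t7 t8 t9 t10 t11 h1 h2 h3 h4 h5 h6 E1.
by field: E1; rewrite h1 h2 h3 h4 h5 h6.
Qed.

(* Watson's 8phi7 transformation. Expanding the factors in [b], [c] by
   [saal_sum] and exchanging the sums leaves 6phi5 sums inside. *)
Lemma watson q a b c d e N :
  q != 0 -> b != 0 -> c != 0 -> d != 0 -> e != 0 ->
  (forall i, 1 - q ^+ i.+1 != 0) ->
  (forall i, 1 - a * q ^+ i.+1 != 0) ->
  (forall i, 1 - a * q / b * q ^+ i != 0) ->
  (forall i, 1 - a * q / c * q ^+ i != 0) ->
  (forall i, 1 - a * q / d * q ^+ i != 0) ->
  (forall i, 1 - a * q / e * q ^+ i != 0) ->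
  \sum_(k < N.+1) vwp_term q a d e N k *
    (poch b q k * poch c q k / (poch (a * q / b) q k * poch (a * q / c) q k) *
     (a * q / (b * c)) ^+ k) =
  \sum_(j < N.+1) poch (a * q / (b * c)) q j * q ^+ j /
    (poch q q j * poch (a * q / b) q j * poch (a * q / c) q j) *
    (poch a q N.+1 * poch (a * q / (d * e)) q (N - j) /
     (poch (a * q / d) q N * poch (a * q / e) q N) *
     (poch d q j * poch e q j * (a * q / (d * e)) ^+ j * qdesc q N j *
      (\prod_(i < j) - q ^+ i) / q ^+ j ^+ j)).
Proof.
move=> q0 b0 c0 d0 e0 hq ha hb hc hd he.
transitivity (\sum_(k < N.+1) \sum_(j < N.+1) vwp_term q a d e N k * saal_term q a b c k j).
  apply: eq_bigr => k _; rewrite -saal_sum // -mulr_sumr; congr (_ * _).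
  (* [qdesc q k j] vanishes for [j > k], so the inner range may be widened to [N]. *)
  rewrite (big_ord_widen _ (saal_term q a b c k) (ltn_ord k)).
  rewrite [RHS](bigID (fun j : 'I__ => (j < k.+1)%N)) /=.
  rewrite [X in _ + X]big1 ?addr0 // => j; rewrite -leqNgt => kj.
  by rewrite /saal_term qdesc_eq0 // mulr0 mul0r mulr0.
rewrite exchange_big; apply: eq_bigr => j _ /=.
have jN : (j <= N)%N by rewrite -ltnS.
have := vwp_saal_sum j (N - j) q0 d0 e0 hq ha hd he.
rewrite subnKC // => <-; rewrite mulr_sumr; apply: eq_bigr => k _.
by rewrite /saal_term mulrCA.
Qed.

(** The product is read backwards, with [1 - y = - y * (1 - y^-1)] applied to each factor. *)
Lemma poch_rev x p k : x != 0 -> p != 0 ->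
  poch x p k = (\prod_(i < k) (- (x * p ^+ i))) * poch (p / (x * p ^+ k)) p k.
Proof.
move=> x0 p0; rewrite {2}/poch [X in _ * X](reindex_inj rev_ord_inj) -big_split /=.
apply: eq_bigr => i _.
have -> : p ^+ k = p ^+ (k - i.+1) * p ^+ i * p by rewrite -exprD -exprSr -addnS subnK.
have := expf_neq0 (k - i.+1) p0; have := expf_neq0 i p0.
by move: (p ^+ i) (p ^+ _) => u v u0 v0; field_nz.
Qed.

Lemma qdesc_inv p N k : p != 0 -> qdesc p N k = p ^+ N ^+ k * poch (p ^+ N)^-1 p k.
Proof.
move=> p0; have N0 := expf_neq0 N p0.
elim: k => [|k IH]; first by rewrite /qdesc big_ord0 poch0 expr0 mulr1.
by rewrite qdescS pochS exprS IH; field.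
Qed.

Lemma exprz_subl1 q k : q != 0 -> q ^ (k%:Z - 1) = q ^+ k / q.
Proof. by move=> q0; rewrite expfzDr // exprnP exprz_inv ?exprN1. Qed.

End Hypergeometric.

(** * The two sides over an arbitrary field *)

Definition lhs_term (F : fieldType) (q a b c d : F) (k : nat) : F :=
    (1 - q ^ ((4 * k)%N%:Z - 1)) / (1 - q) *
    (poch (a / q) (q ^+ 2) k * poch (q^-1 / a) (q ^+ 2) k * poch (q^-1 / b) (q ^+ 2) k *
     poch (c / q) (q ^+ 2) k * poch (d / q) (q ^+ 2) k * poch (q^-1) (q ^+ 2) k) /
    (poch (q ^+ 2 / a) (q ^+ 2) k * poch (a * q ^+ 2) (q ^+ 2) k * poch (b * q ^+ 2) (q ^+ 2) k *
     poch (q ^+ 2 / c) (q ^+ 2) k * poch (q ^+ 2 / d) (q ^+ 2) k * poch (q ^+ 2) (q ^+ 2) k) *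
    (b * q ^+ 7 / (c * d)) ^+ k.

Definition rhs_term (F : fieldType) (q a b c d : F) (k : nat) : F :=
    (poch (a / q) (q ^+ 2) k * poch (q^-1 / a) (q ^+ 2) k * poch (q^-1 / b) (q ^+ 2) k *
     poch (q ^+ 3 / (c * d)) (q ^+ 2) k) /
    (poch (q ^+ 2) (q ^+ 2) k * poch ((q ^+ 2)^-1 / b) (q ^+ 2) k * poch (q ^+ 2 / c) (q ^+ 2) k *
     poch (q ^+ 2 / d) (q ^+ 2) k) * q ^+ (2 * k)%N.

Definition rhs_factor (F : fieldType) (q b : F) (n m : nat) : F :=
  (1 - q ^ n%:Z) / (1 - q) * (b * q) ^+ m * poch ((q ^+ 2)^-1 / b) (q ^+ 2) m /
  poch (b * q ^+ 2) (q ^+ 2) m.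

Section Specialisation.
Variable F : fieldType.
Variables q a b c d : F.
Hypotheses (q0 : q != 0) (b0 : b != 0) (c0 : c != 0) (d0 : d != 0).

(** This symmetry reduces the point [a = q ^+ n] to [a = q ^- n]. *)
Lemma lhs_termV k : lhs_term q a^-1 b c d k = lhs_term q a b c d k.
Proof.
rewrite /lhs_term !invrK (mulrC a^-1 q^-1) (mulrC q^-1 a) (mulrC a^-1) (mulrC (q ^+ 2) a).
by rewrite (mulrC (poch (q^-1 / a) _ _)) (mulrC (poch (a * q ^+ 2) _ _)).
Qed.

Lemma rhs_termV k : rhs_term q a^-1 b c d k = rhs_term q a b c d k.
Proof.
rewrite /rhs_term !invrK (mulrC a^-1) (mulrC q^-1 a).
by rewrite (mulrC (poch (q^-1 / a) _ _)).
Qed.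

Lemma lhs_term_eq0 k i : (i < k)%N ->
  [|| 1 - a / q * q ^+ 2 ^+ i == 0, 1 - q^-1 / a * q ^+ 2 ^+ i == 0
    | 1 - q^-1 * q ^+ 2 ^+ i == 0] -> lhs_term q a b c d k = 0.
Proof.
move=> ik /or3P[] /eqP /(poch_eq0 ik) e;
  by rewrite /lhs_term e ?(mulr0, mul0r).
Qed.

Let mul_divK (x u v w z : F) : x != 0 -> x * (u / x * v / w * z) = u * v / w * z.
Proof. by move=> x0; rewrite !mulrA (mulrC x) mulfK. Qed.

(** * Watson's transformation at [a = q ^- n], where [n + 1 = 2 * m] *)

Section Watson.
Variable m : nat.
Hypothesis aE : a = q / q ^+ 2 ^+ m.
Hypothesis hq : forall i, 1 - q ^+ i.+1 != 0.
Hypothesis ha : forall i, 1 - a * q ^+ 2 * q ^+ 2 ^+ i != 0.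
Hypothesis hb : forall i, 1 - b * q ^+ 2 * q ^+ 2 ^+ i != 0.
Hypothesis hb' : forall i, 1 - (q ^+ 2)^-1 / b * q ^+ 2 ^+ i != 0.
Hypothesis hc : forall i, 1 - q ^+ 2 / c * q ^+ 2 ^+ i != 0.
Hypothesis hd : forall i, 1 - q ^+ 2 / d * q ^+ 2 ^+ i != 0.

Let Q0 : q ^+ 2 != 0. Proof. by rewrite expf_neq0. Qed.
Let T0 : q ^+ 2 ^+ m != 0. Proof. by rewrite expf_neq0. Qed.
Let a0 : a != 0. Proof. by rewrite aE mulf_neq0 ?invr_eq0. Qed.

Let Ea : q^-1 * q ^+ 2 / (q^-1 / a) = a * q ^+ 2.
Proof. field_nz. Qed.
Let Eb : q^-1 * q ^+ 2 / (q^-1 / b) = b * q ^+ 2.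
Proof. field_nz. Qed.
Let Ec : q^-1 * q ^+ 2 / (c / q) = q ^+ 2 / c.
Proof. field_nz. Qed.
Let Ed : q^-1 * q ^+ 2 / (d / q) = q ^+ 2 / d.
Proof. field_nz. Qed.
Let Eab : q^-1 * q ^+ 2 / (q^-1 / a * (q^-1 / b)) = a * b * q ^+ 3.
Proof. field_nz. Qed.
Let Ecd : q^-1 * q ^+ 2 / (c / q * (d / q)) = q ^+ 3 / (c * d).
Proof. field_nz. Qed.

Let hq2 i : 1 - q ^+ 2 ^+ i.+1 != 0.
Proof. by rewrite -exprM mulnS; apply: (hq (1 + 2 * i)). Qed.

Let hA i : 1 - q^-1 * q ^+ 2 ^+ i.+1 != 0.
Proof. by rewrite -exprM mulnS exprS mulKf //; apply: (hq (2 * i)). Qed.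

Let q1 : 1 - q != 0. Proof. exact: (hq 0). Qed.

(** Dictionary for Watson's transformation: base [q ^+ 2], leading parameter [q^-1], then [c / q],
    [d / q], [q^-1 / a], [q^-1 / b]. As [a / q] is the inverse of [q ^+ 2 ^+ m], its shifted
    factorial supplies the terminating factor [qdesc]. *)
Lemma lhs_term_watson k :
  vwp_term (q ^+ 2) q^-1 (q^-1 / a) (q^-1 / b) m k *
    (poch (c / q) (q ^+ 2) k * poch (d / q) (q ^+ 2) k /
     (poch (q ^+ 2 / c) (q ^+ 2) k * poch (q ^+ 2 / d) (q ^+ 2) k) *
     (q ^+ 3 / (c * d)) ^+ k) = (1 - q) * lhs_term q a b c d k.
Proof.
rewrite /vwp_term /lhs_term Ea Eb Eab exprz_subl1 // qdesc_inv //.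
have -> : q^-1 * q ^+ 2 ^+ m.+1 = q ^+ 2 / a.
  by rewrite aE exprS; field_nz.
have -> : (q ^+ 2 ^+ m)^-1 = a / q by rewrite aE; field_nz.
have -> : (b * q ^+ 7 / (c * d)) ^+ k =
    (a * b * q ^+ 3) ^+ k * q ^+ 2 ^+ m ^+ k * (q ^+ 3 / (c * d)) ^+ k.
  by rewrite -!exprMn; congr (_ ^+ k); rewrite aE; field_nz.
have -> : q^-1 * q ^+ 2 ^+ (2 * k) = q ^+ (4 * k) / q by rewrite -exprM mulnA mulrC.
by rewrite mul_divK // !invfM; ring.
Qed.

(** Reversing the shifted factorial of [a * q ^+ 2] yields that of [q^-1], which cancels all but the
    last factor of the one of length [m.+1] and leaves [1 - q ^+ (2 * m) / q]. Reversing that of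
    [a * b * q ^+ 3] yields the quotient of those of [(q ^+ 2)^-1 / b] of lengths [m] and [j]. *)
Lemma rhs_term_watson j : (j <= m)%N ->
  poch (q ^+ 3 / (c * d)) (q ^+ 2) j * q ^+ 2 ^+ j /
    (poch (q ^+ 2) (q ^+ 2) j * poch (q ^+ 2 / c) (q ^+ 2) j * poch (q ^+ 2 / d) (q ^+ 2) j) *
    (poch q^-1 (q ^+ 2) m.+1 * poch (a * b * q ^+ 3) (q ^+ 2) (m - j) /
     (poch (a * q ^+ 2) (q ^+ 2) m * poch (b * q ^+ 2) (q ^+ 2) m) *
     (poch (q^-1 / a) (q ^+ 2) j * poch (q^-1 / b) (q ^+ 2) j * (a * b * q ^+ 3) ^+ j *
      qdesc (q ^+ 2) m j * (\prod_(i < j) - q ^+ 2 ^+ i) / q ^+ 2 ^+ j ^+ j)) =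
  (1 - q ^+ (2 * m) / q) * (b * q) ^+ m * poch ((q ^+ 2)^-1 / b) (q ^+ 2) m /
  poch (b * q ^+ 2) (q ^+ 2) m * rhs_term q a b c d j.
Proof.
move=> jm; rewrite /rhs_term.
have rev1 : poch (a * q ^+ 2) (q ^+ 2) m =
    (\prod_(i < m) - (a * q ^+ 2 * q ^+ 2 ^+ i)) * poch q^-1 (q ^+ 2) m.
  rewrite poch_rev ?mulf_neq0 //; congr (_ * poch _ _ _).
  by rewrite aE; field_nz.
have rev2 : poch (a * b * q ^+ 3) (q ^+ 2) (m - j) =
    (\prod_(i < m - j) - (a * b * q ^+ 3 * q ^+ 2 ^+ i)) *
    (poch ((q ^+ 2)^-1 / b) (q ^+ 2) m / poch ((q ^+ 2)^-1 / b) (q ^+ 2) j).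
  rewrite -[X in poch _ _ X / _](subnKC jm) poch_add [X in _ = _ * X]mulrAC divff ?mul1r ?poch_neq0 //.
  rewrite poch_rev ?mulf_neq0 ?expf_neq0 //; congr (_ * poch _ _ _).
  have := subnK jm; move: (m - j)%N => l; rewrite aE => <-; rewrite exprD.
  have := expf_neq0 l Q0; have := expf_neq0 j Q0.
  by move: (q ^+ 2 ^+ l) (q ^+ 2 ^+ j) => x y y0 x0; field_nz.
have P0 : \prod_(i < m) - (a * q ^+ 2 * q ^+ 2 ^+ i) != 0.
  by apply/prodf_neq0 => i _; rewrite oppr_eq0 !mulf_neq0 ?expf_neq0.
(* The monomials left by the two reversals, together with the powers in Watson's summand, collapse
   to [(b * q) ^+ m]; here [l] stands for [m - j]. *)
have prodE l : (b * q) ^+ (l + j) * \prod_(i < l + j) - (a * q ^+ 2 * q ^+ 2 ^+ i) =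
    \prod_(i < l) - (a * b * q ^+ 3 * q ^+ 2 ^+ i) *
    ((a * b * q ^+ 3 * q ^+ 2 ^+ (l + j)) ^+ j * (\prod_(i < j) - q ^+ 2 ^+ i) / q ^+ 2 ^+ j ^+ j).
  have exprE x k : x ^+ k = \prod_(i < k) x :> F by rewrite prodr_const card_ord.
  rewrite exprE -big_split big_split_ord /=; congr (_ * _).
    by apply: eq_bigr => i _; ring.
  rewrite mulrAC -expr_div_n [X in _ = X * _]exprE -big_split /=.
  apply: eq_bigr => i _; rewrite !exprD; have := expf_neq0 j Q0.
  by move: (q ^+ 2 ^+ j) => y y0; field.
have {prodE} := prodE (m - j)%N; rewrite subnK // => prodE.
have Aq : poch q^-1 (q ^+ 2) m != 0.
  (* The factor of index [0] is [1 - q^-1], which [hA] does not cover. *)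
  apply/poch_neq0 => -[|i] _; last by [].
  rewrite expr0 mulr1; have -> : 1 - q^-1 = - (1 - q) / q by field.
  by rewrite mulf_neq0 ?oppr_eq0 ?invr_eq0.
rewrite qdesc_inv // rev1 rev2 pochS.
have -> : (q ^+ 2 ^+ m)^-1 = a / q by rewrite aE; field_nz.
have -> : (1 - q ^+ (2 * m) / q) * (b * q) ^+ m = (1 - q^-1 * q ^+ 2 ^+ m) *
    (\prod_(i < m - j) - (a * b * q ^+ 3 * q ^+ 2 ^+ i) *
    ((a * b * q ^+ 3 * q ^+ 2 ^+ m) ^+ j * (\prod_(i < j) - q ^+ 2 ^+ i) / q ^+ 2 ^+ j ^+ j)) /
    (\prod_(i < m) - (a * q ^+ 2 * q ^+ 2 ^+ i)).
  by rewrite -prodE exprM; field_nz.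
rewrite (exprMn j (a * b * q ^+ 3)) (exprM q 2 j) !invfM.
rewrite -[RHS]mulr1 -(divff Aq); ring.
Qed.

Lemma watson_specialised n : n.+1 = (2 * m)%N ->
  \sum_(k < m.+1) lhs_term q a b c d k =
  rhs_factor q b n m * \sum_(k < m.+1) rhs_term q a b c d k.
Proof.
move=> nm; apply: (mulfI q1); rewrite mulr_sumr.
under eq_bigr do rewrite -lhs_term_watson.
have := @watson F (q ^+ 2) q^-1 (c / q) (d / q) (q^-1 / a) (q^-1 / b) m.
rewrite Ea Eb Ec Ed Eab Ecd => W; rewrite W ?mulf_neq0 ?invr_eq0 {W}//.
rewrite [RHS]mulrA mulr_sumr; apply: eq_bigr => j _.
rewrite rhs_term_watson -1?ltnS // /rhs_factor !(mulrA (1 - q)) (mulrC (1 - q)) mulfK //.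
by rewrite -nm exprSr mulfK.
Qed.

End Watson.

(** * Cancellation at a root of unity, with [q ^+ n = 1] used as [q ^+ (2 * m) = q] *)

Section RootOfUnity.
Variable m : nat.
Hypothesis qm : q ^+ 2 ^+ m = q.

Definition wp_ratio (x : F) k := poch (x / q) (q ^+ 2) k / poch (q ^+ 2 / x) (q ^+ 2) k.

(** The divisor is chosen so that the well-poised quotient becomes invariant under [k -> m - k]. *)
Definition wp_norm x k := wp_ratio x k / ((- (x / q ^+ 2)) ^+ k * q ^+ (k * k)).

(** The shifted factorial of [x / q] of length [m] is computed twice, split at [k] and split at [l],
    with the tail reversed each time. Since [x / q * q ^+ 2 ^+ m = x], the reversed tail is a
    shifted factorial of [q ^+ 2 / x]. *)
Lemma wp_norm_sym x k l : (k + l = m)%N -> x != 0 ->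
  (forall i, (i < m)%N -> 1 - q ^+ 2 / x * q ^+ 2 ^+ i != 0) ->
  wp_norm x l = wp_norm x k.
Proof.
move=> klm x0 hx.
have Q0 : q ^+ 2 != 0 by rewrite expf_neq0.
have rev i j : (i + j = m)%N -> poch (x / q) (q ^+ 2) m =
    poch (x / q) (q ^+ 2) j * ((- (x / q ^+ 2)) ^+ i * q ^+ (i * i) * q ^+ 2 ^+ (i * j)) *
    poch (q ^+ 2 / x) (q ^+ 2) i.
  move=> ijm; rewrite -ijm addnC poch_add (@poch_rev _ (x / q * _)) ?mulf_neq0 ?expf_neq0 ?invr_eq0 //.
  have -> : x / q * q ^+ 2 ^+ j * q ^+ 2 ^+ i = x.
    by rewrite -mulrA -exprD addnC ijm qm; field.
  rewrite mulrA; congr (_ * _ * _).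
  elim: i {ijm} => [|i IH]; first by rewrite big_ord0 !mul0n !expr0 !mulr1.
  have -> : (i.+1 * i.+1 = i * i + (i + i).+1)%N by rewrite mulSn mulnS addnA addnC addSn.
  have Ei : q ^+ 2 ^+ i = q ^+ i * q ^+ i by rewrite -exprM mul2n -addnn exprD.
  rewrite big_ord_recr /= IH mulSn (exprD _ j) (exprD _ (i * i)) (exprS _ i) (exprS q (i + i)) (exprD q i i) Ei.
  by field_nz.
have Px j : (j <= m)%N -> poch (q ^+ 2 / x) (q ^+ 2) j != 0.
  by move=> jm; apply: poch_neq0 => i ij; apply: hx; apply: leq_trans ij jm.
have := rev _ _ klm; rewrite (rev l k) 1?addnC // mulnC.
have := Px k; have := Px l; rewrite -klm leq_addl leq_addr => /(_ isT) h1 /(_ isT) h2.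
have y0 : - (x / q ^+ 2) != 0 by rewrite oppr_eq0 mulf_neq0 ?invr_eq0.
have h3 := expf_neq0 k y0; have h4 := expf_neq0 l y0.
have h5 := expf_neq0 (k * k) q0; have h6 := expf_neq0 (l * l) q0.
have h7 := expf_neq0 (k * l) Q0.
rewrite /wp_norm /wp_ratio.
move: (q ^+ 2 ^+ (k * l)) (q ^+ (l * l)) (q ^+ (k * k)) (_ ^+ k) (_ ^+ l) h1 h2 h3 h4 h5 h6 h7.
move=> t1 t2 t3 t4 t5 h1 h2 h3 h4 h5 h6 h7 E.
(* The cross factor [t1] occurs on both sides and is cancelled. *)
have {}E : poch (x / q) (q ^+ 2) k * (t5 * t2) * poch (q ^+ 2 / x) (q ^+ 2) l =
    poch (x / q) (q ^+ 2) l * (t4 * t3) * poch (q ^+ 2 / x) (q ^+ 2) k.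
  by apply: (mulIf h7); ring: E.
by field: E; do ?[apply/andP; split].
Qed.

Hypotheses (a0 : a != 0)
  (ha : forall i, (i < m)%N -> 1 - q ^+ 2 / a * q ^+ 2 ^+ i != 0)
  (ha' : forall i, (i < m)%N -> 1 - a * q ^+ 2 * q ^+ 2 ^+ i != 0)
  (hb : forall i, (i < m)%N -> 1 - b * q ^+ 2 * q ^+ 2 ^+ i != 0)
  (hc : forall i, (i < m)%N -> 1 - q ^+ 2 / c * q ^+ 2 ^+ i != 0)
  (hd : forall i, (i < m)%N -> 1 - q ^+ 2 / d * q ^+ 2 ^+ i != 0)
  (hq : forall i, (i < m)%N -> 1 - q ^+ 2 * q ^+ 2 ^+ i != 0).

(** The six quotients are well-poised, with parameters [a], [a^-1], [b^-1], [c], [d] and [1]. The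
    argument of the series is what cancels [a], [b], [c], [d] from the product of the normalising
    factors. *)
Lemma lhs_term_norm k : lhs_term q a b c d k =
  (wp_norm a k * wp_norm a^-1 k * wp_norm b^-1 k * wp_norm c k * wp_norm d k * wp_norm 1 k) *
  ((1 - q ^+ (4 * k) / q) / (1 - q) * (q ^+ (k * k) ^+ 6 / q ^+ k ^+ 5)).
Proof.
pose w (x : F) := (- (x / q ^+ 2)) ^+ k * q ^+ (k * k).
have w0 (x : F) : x != 0 -> w x != 0.
  by move=> x0; rewrite mulf_neq0 ?expf_neq0 // oppr_eq0 mulf_neq0 ?invr_eq0 ?expf_neq0.
have -> : q ^+ (k * k) ^+ 6 / q ^+ k ^+ 5 = (b * q ^+ 7 / (c * d)) ^+ k *
    (w a * w a^-1 * w b^-1 * w c * w d * w 1).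
  rewrite (exprAC q k 5) -exprVn.
  have -> : (q ^+ 5)^-1 = b * q ^+ 7 / (c * d) * (- (a / q ^+ 2)) * (- (a^-1 / q ^+ 2)) *
     (- (b^-1 / q ^+ 2)) * (- (c / q ^+ 2)) * (- (d / q ^+ 2)) * (- (1 / q ^+ 2)).
    by field_nz.
  by rewrite /w 6!exprMn; ring.
rewrite /lhs_term exprz_subl1 // /wp_norm /wp_ratio !invrK div1r divr1.
rewrite (mulrC q^-1 a^-1) (mulrC q^-1 b^-1) (mulrC a (q ^+ 2)) (mulrC b (q ^+ 2)).
rewrite -/(w a) -/(w a^-1) -/(w b^-1) -/(w c) -/(w d) -/(w 1).
have [h1 h2 h3] : [/\ w a != 0, w a^-1 != 0 & w b^-1 != 0] by rewrite !w0 ?invr_eq0.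
have [h4 h5 h6] : [/\ w c != 0, w d != 0 & w 1 != 0] by rewrite !w0 ?oner_eq0.
move: (w a) (w a^-1) (w b^-1) (w c) (w d) (w 1) h1 h2 h3 h4 h5 h6.
move=> u1 u2 u3 u4 u5 u6 h1 h2 h3 h4 h5 h6.
have U0 : u1 * u2 * u3 * u4 * u5 * u6 != 0 by rewrite !mulf_neq0.
by rewrite -[LHS]mulr1 -(divff U0) !invfM; ring.
Qed.

(** As [q ^+ (2 * m) = q], the exponent [6 * k * k] of [q] may be replaced by [3 * k - 6 * k * l].
    Up to quantities symmetric in [k] and [l], the last factor is then
    [q ^- (2 * k) - q ^ (2 * k - 1)], whose two terms are exchanged with [l] for [k] because
    [q ^+ (2 * k + 2 * l) = q]. *)
Lemma lhs_term_antisym k l : (k + l = m)%N -> lhs_term q a b c d l = - lhs_term q a b c d k.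
Proof.
move=> klm; rewrite !lhs_term_norm -[RHS]mulrN.
have -> : wp_norm a l = wp_norm a k by apply: wp_norm_sym.
have -> : wp_norm c l = wp_norm c k by apply: wp_norm_sym.
have -> : wp_norm d l = wp_norm d k by apply: wp_norm_sym.
have -> : wp_norm a^-1 l = wp_norm a^-1 k.
  by apply: wp_norm_sym; rewrite ?invr_eq0 // => i im; rewrite invrK (mulrC _ a) ha'.
have -> : wp_norm b^-1 l = wp_norm b^-1 k.
  by apply: wp_norm_sym; rewrite ?invr_eq0 // => i im; rewrite invrK (mulrC _ b) hb.
have -> : wp_norm 1 l = wp_norm 1 k.
  by apply: wp_norm_sym; rewrite ?oner_eq0 // => i im; rewrite divr1 hq.
congr (_ * _).
have Q0 : q ^+ 2 != 0 by rewrite expf_neq0.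
have E3 i j : (i + j = m)%N -> q ^+ (i * i) ^+ 6 = q ^+ i ^+ 3 / q ^+ (i * j) ^+ 6.
  move=> ijm; apply: (canRL (mulfK _)); first by rewrite !expf_neq0.
  have e : (i * m * 6 = 2 * m * (3 * i))%N by rewrite mulnACA [RHS]mulnC (mulnC m).
  by rewrite -exprMn -exprD -mulnDr ijm -exprM e (exprM q (2 * m)) (exprM q 2 m) qm mulnC exprM.
rewrite (E3 _ _ klm) (E3 l k) 1?addnC // (mulnC l).
have E2 : q ^+ k ^+ 2 * q ^+ l ^+ 2 = q by rewrite -exprMn -exprD klm -exprM mulnC exprM qm.
have E4 i : q ^+ (4 * i) = q ^+ i ^+ 4 by rewrite mulnC exprM.
rewrite !E4.
have := expf_neq0 (k * l) q0; have := expf_neq0 k q0; have := expf_neq0 l q0.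
move: (q ^+ (k * l)) (q ^+ k) (q ^+ l) (1 - q)^-1 E2 => t u v iq <- v0 u0 t0.
by field_nz.
Qed.

Lemma lhs_sum_eq0 : (2%:R != 0 :> F) -> \sum_(k < m.+1) lhs_term q a b c d k = 0.
Proof.
move=> two0; set S := \sum_(k < _) _.
have SN : S = - S.
  rewrite {1}/S (reindex_inj rev_ord_inj) -sumrN; apply: eq_bigr => k _ /=.
  by rewrite subSS; apply: lhs_term_antisym; rewrite subnKC // -ltnS.
by apply: (mulfI two0); rewrite mulr0 mulr2n mulrDl !mul1r {1}SN addNr.
Qed.

End RootOfUnity.
End Specialisation.

(** * Congruences and evaluation *)

Section Specialise.
Variables (R : idomainType) (K : fieldType) (J : Type) (phi : J -> {rmorphism R -> K}).
Local Notation tof := (@FracField.tofrac R).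

(** A relation rather than a function, since only some fractions have a value. One representation
    [N / D] must serve every [j]: its denominator is the one exhibited in the congruence. *)
Definition specialises (x : {fraction R}) (y : J -> K) : Prop :=
  exists N D : R, [/\ forall j, phi j D != 0, x = tof N / tof D &
    forall j, y j = phi j N / phi j D].

Lemma tof_neq0 (j : J) (D : R) : phi j D != 0 -> tof D != 0.
Proof.
by rewrite tofrac_eq0; apply: contraNneq => ->; rewrite rmorph0.
Qed.

Variable j0 : J.

Lemma specialises_ext x y y' : (forall j, y j = y' j) ->
  specialises x y -> specialises x y'.
Proof. by move=> e [N [D [hD hx hy]]]; exists N, D; split=> // j; rewrite -e. Qed.

Lemma specialises_tof N : specialises (tof N) (fun j => phi j N).
Proof.
exists N, 1; split=> [j||j]; rewrite ?rmorph1 ?oner_neq0 ?divr1 //.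
Qed.

Lemma specialises1 : specialises 1 (fun=> 1).
Proof.
have := specialises_tof 1; rewrite tofrac1.
by apply: specialises_ext => j; rewrite rmorph1.
Qed.

Lemma specialisesD x y x' y' : specialises x y -> specialises x' y' ->
  specialises (x + x') (fun j => y j + y' j).
Proof.
move=> [N [D [hD -> hy]]] [N' [D' [hD' -> hy']]].
exists (N * D' + N' * D), (D * D'); split=> [j||j].
- by rewrite rmorphM mulf_neq0.
- have := tof_neq0 (hD j0); have := tof_neq0 (hD' j0).
  by move=> h h'; rewrite tofracD !tofracM addf_div.
- by rewrite hy hy' rmorphD !rmorphM addf_div.
Qed.

Lemma specialisesM x y x' y' : specialises x y -> specialises x' y' ->
  specialises (x * x') (fun j => y j * y' j).
Proof.
move=> [N [D [hD -> hy]]] [N' [D' [hD' -> hy']]].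
exists (N * N'), (D * D'); split=> [j||j].
- by rewrite rmorphM mulf_neq0.
- by rewrite !tofracM mulf_div.
- by rewrite hy hy' !rmorphM mulf_div.
Qed.

Lemma specialisesN x y : specialises x y -> specialises (- x) (fun j => - y j).
Proof.
move=> [N [D [hD -> hy]]]; exists (- N), D; split=> // [|j].
- by rewrite tofracN mulNr.
- by rewrite hy rmorphN mulNr.
Qed.

Lemma specialisesB x y x' y' : specialises x y -> specialises x' y' ->
  specialises (x - x') (fun j => y j - y' j).
Proof. by move=> h /specialisesN; apply: specialisesD. Qed.

Lemma specialisesV x y : (forall j, y j != 0) -> specialises x y ->
  specialises x^-1 (fun j => (y j)^-1).
Proof.
move=> y0 [N [D [hD -> hy]]]; exists D, N; split=> [j||j].
- by have := y0 j; rewrite hy mulf_eq0 negb_or => /andP[].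
- by rewrite invf_div.
- by rewrite hy invf_div.
Qed.

Lemma specialises_div x y x' y' : (forall j, y' j != 0) ->
  specialises x y -> specialises x' y' ->
  specialises (x / x') (fun j => y j / y' j).
Proof. by move=> h hx hx'; apply: specialisesM => //; apply: specialisesV. Qed.

Lemma specialisesX x y k : specialises x y -> specialises (x ^+ k) (fun j => y j ^+ k).
Proof.
move=> h; elim: k => [|k IH]; first exact: specialises1.
by rewrite exprS; apply: specialises_ext (specialisesM h IH) => j; rewrite exprS.
Qed.

Lemma specialises_sum n x y : (forall k, (k < n)%N -> specialises (x k) (y^~ k)) ->
  specialises (\sum_(k < n) x k) (fun j => \sum_(k < n) y j k).
Proof.
elim: n => [|n IH] h.
  have := specialises_tof 0; rewrite big_ord0 tofrac0.
  by apply: specialises_ext => j; rewrite rmorph0 big_ord0.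
rewrite big_ord_recr /=.
have h1 := IH (fun k kn => h k (leqW kn)).
apply: specialises_ext (specialisesD h1 (h n (ltnSn n))) => j.
by rewrite big_ord_recr.
Qed.

Lemma specialises_prod n x y : (forall k, (k < n)%N -> specialises (x k) (y^~ k)) ->
  specialises (\prod_(k < n) x k) (fun j => \prod_(k < n) y j k).
Proof.
elim: n => [|n IH] h.
  by rewrite big_ord0; apply: specialises_ext specialises1 => j; rewrite big_ord0.
rewrite big_ord_recr /=.
have h1 := IH (fun k kn => h k (leqW kn)).
apply: specialises_ext (specialisesM h1 (h n (ltnSn n))) => j.
by rewrite big_ord_recr.
Qed.

End Specialise.

(** * Regular elements and coprimality *)

Section Regular.
Variable R : idomainType.
Implicit Types D P g h : R.

Definition rdvd g p := exists h, p = g * h.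

(** [D] is a non-zero-divisor modulo [P], a property that passes to products of moduli and implies
    coprimality. *)
Definition regular_mod D P := forall h, rdvd P (D * h) -> rdvd P h.

Lemma regular_modM D P1 P2 : P1 != 0 ->
  regular_mod D P1 -> regular_mod D P2 -> regular_mod D (P1 * P2).
Proof.
move=> P10 r1 r2 h [x hx].
have [h' e] : rdvd P1 h by apply: r1; exists (P2 * x); rewrite mulrA.
have [h'' e'] : rdvd P2 h'.
  apply: r2; exists x; apply: (mulfI P10).
  by rewrite [RHS]mulrA -hx e mulrCA.
by exists h''; rewrite e e' mulrA.
Qed.

(* If [P = g P'] and [g] divides [D], then [P] divides [D P'], hence [P'], so
   [g] is invertible: no unique factorisation is needed. *)
Lemma regular_mod_unit D P g : P != 0 -> regular_mod D P ->
  rdvd g D -> rdvd g P -> g \is a GRing.unit.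
Proof.
move=> P0 r [D' eD] [P' eP].
have [w e] : rdvd P P' by apply: r; exists D'; rewrite eD {1}eP mulrAC.
apply/unitrPr; exists w; apply: (mulfI P0).
by rewrite mulr1 {2}eP e mulrCA.
Qed.

Section Kernel.
Variables (K : fieldType) (f : {rmorphism R -> K}) (P : R).
Hypothesis kerf : forall h, f h = 0 <-> rdvd P h.

(** Modulo [P] the ring embeds in a field, where every non-zero element can be cancelled. *)
Lemma regular_mod_ker D : f D != 0 -> regular_mod D P.
Proof.
move=> fD h /kerf /eqP; rewrite rmorphM mulf_eq0 (negPf fD) /= => /eqP.
by move/kerf.
Qed.

Lemma rdvd_kerM g h : f g != 0 -> f (g * h) = 0 -> rdvd P h.
Proof. by move=> fg /kerf; apply: regular_mod_ker. Qed.
End Kernel.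
End Regular.

(** * Kernels of substitutions *)

(** Used to collect the monomials of a polynomial according to their part outside one variable. *)
Lemma big_partition_seq (V : nmodType) (I : Type) (T : eqType) (f : I -> T)
    (r : seq I) (s : seq T) (F : I -> V) :
  uniq s -> all (fun i => f i \in s) r ->
  \sum_(i <- r) F i = \sum_(t <- s) \sum_(i <- r | f i == t) F i.
Proof.
move=> us; elim: r => [|i r IH] /=; first by rewrite big_nil big1 // => t _; rewrite big_nil.
case/andP=> fis /IH {}IH; rewrite big_cons {}IH.
rewrite [in LHS](bigD1_seq (f i)) //= [RHS](bigD1_seq (f i)) //= addrA.
congr (_ + _); first by rewrite big_cons eqxx.
by apply: eq_bigr => t tfi; rewrite big_cons eq_sym (negPf tfi).
Qed.

Section CyclotomicKernel.
Variables (N : nat) (i0 : 'I_N) (n : nat) (z : algC).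
Hypothesis prim_z : n.-primitive_root z.

Definition cancel_var (m : 'X_{1.. N}) : 'X_{1.. N} :=
  [multinom (if i == i0 then 0%N else m i) | i < N].

Lemma cancel_varE (m : 'X_{1.. N}) : m = (U_(i0) *+ m i0 + cancel_var m)%MM.
Proof.
apply/mnmP => i; rewrite mnmDE mulmnE mnm1E mnmE eq_sym.
by case: eqP => [->|_]; rewrite ?mul1n ?mul0n ?addn0.
Qed.

Lemma mpolyX_cancel (R : nzRingType) (m : 'X_{1.. N}) :
  'X_[m] = 'X_i0 ^+ m i0 * 'X_[cancel_var m] :> {mpoly R[N]}.
Proof. by rewrite mpolyXn -mpolyXD -cancel_varE. Qed.

Definition ratmC : {rmorphism rat -> {mpoly algC[N]}} := @mpolyC N algC \o (@ratr algC).

Definition root_subst : {mpoly rat[N]} -> {mpoly algC[N]} :=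
  mmap ratmC (fun i => if i == i0 then z%:MP else 'X_i).

Lemma root_substX (m : 'X_{1.. N}) : root_subst 'X_[m] = z ^+ m i0 *: 'X_[cancel_var m].
Proof.
rewrite /root_subst mmapX /mmap1 (bigD1 i0) //= eqxx -rmorphXn /= mul_mpolyC.
congr (_ *: _); rewrite mpolyXE_id [RHS](bigD1 i0) //= mnmE eqxx expr0 mul1r.
by apply: eq_bigr => i ii0; rewrite mnmE (negPf ii0).
Qed.

Lemma root_substE h : root_subst h =
  \sum_(m <- msupp h) (ratr h@_m * z ^+ m i0) *: 'X_[cancel_var m].
Proof.
rewrite {1}[h]mpolyE /root_subst rmorph_sum; apply: eq_bigr => m _.
by rewrite -mul_mpolyC rmorphM /= mmapC [X in _ * X]root_substX mul_mpolyC scalerA.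
Qed.

Definition eval_var (p : {poly rat}) : {mpoly rat[N]} := (map_poly (@mpolyC N rat) p).['X_i0].

(** View [h] as a polynomial in the other variables whose coefficients [cp t] are rational
    polynomials in one variable. If the image vanishes, [z] is a root of every [cp t], so its
    minimal polynomial divides each of them. *)
Lemma ker_root_subst h : root_subst h = 0 ->
  rdvd (map_poly (fun k : int => k%:~R) 'Phi_n).['X_i0] h.
Proof.
move=> h0.
pose s := undup [seq cancel_var m | m <- msupp h].
pose cp t := \sum_(m <- msupp h | cancel_var m == t) h@_m *: 'X^(m i0) : {poly rat}.
have hE : h = \sum_(t <- s) eval_var (cp t) * 'X_[t].
  rewrite {1}[h]mpolyE (@big_partition_seq _ _ _ cancel_var _ s) ?undup_uniq //; last first.
    by apply/allP => m mh; rewrite mem_undup map_f.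
  apply: eq_bigr => t _; rewrite /eval_var /cp rmorph_sum horner_sum mulr_suml.
  apply: eq_bigr => m /eqP <-.
  by rewrite /= map_polyZ map_polyXn hornerZ hornerXn -mulrA -mpolyX_cancel mul_mpolyC.
(* The coefficient of ['X_[t]] in the image of [h] is the value of [cp t] at [z]. *)
have root_cp t : root (map_poly ratr (cp t)) z.
  have := congr1 (mcoeff t) h0; rewrite root_substE raddf_sum mcoeff0 => e.
  rewrite /root /cp rmorph_sum horner_sum; apply/eqP; apply: etrans e.
  rewrite [RHS](bigID (fun m => cancel_var m == t)) /=.
  rewrite [X in _ + X]big1 ?addr0; last first.
    by move=> m mt; rewrite mcoeffZ mcoeffX (negPf mt) mulr0.
  apply: eq_bigr => m mt.
  by rewrite mcoeffZ mcoeffX mt mulr1 map_polyZ map_polyXn hornerZ hornerXn.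
have dvd_cp t : exists u : {poly rat}, cp t = map_poly (fun k : int => k%:~R) 'Phi_n * u.
  have [p [pE _ pP]] := minCpolyP z.
  (* The minimal polynomial of [z] over the rationals is the cyclotomic polynomial; the equality is
     checked in [algC] and pulled back. *)
  have <- : p = map_poly (fun k : int => k%:~R) 'Phi_n.
    apply: (@map_poly_inj _ _ (ratr : {rmorphism rat -> algC})).
    rewrite -pE (minCpoly_cyclotomic prim_z) -(Cintr_Cyclotomic prim_z) -map_poly_comp.
    by apply: eq_map_poly => k /=; rewrite rmorph_int.
  by have := root_cp t; rewrite pP => /dvdpP[u ->]; exists u; rewrite mulrC.
have {root_cp} dvd_eval t : rdvd (map_poly (fun k : int => k%:~R) 'Phi_n).['X_i0] (eval_var (cp t)).
  have [u ->] := dvd_cp t; exists (eval_var u).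
  rewrite /eval_var rmorphM /= hornerM; congr (_ * _); rewrite -map_poly_comp /=; congr (_.[_]).
  by apply: eq_map_poly => k /=; rewrite rmorph_int.
rewrite hE; elim: s {hE} => [|t s [g IH]]; first by rewrite big_nil; exists 0; rewrite mulr0.
have [u e] := dvd_eval t.
by rewrite big_cons IH e; exists (u * 'X_[t] + g); rewrite mulrDr mulrA.
Qed.
End CyclotomicKernel.

(** * Kernel of a substitution, after clearing denominators *)

Section SubstitutionKernel.
Variables (N : nat) (k : fieldType) (K : fieldType).
Variables (phi emb : {rmorphism {mpoly k[N]} -> K}) (P u : {mpoly k[N]}).
Hypothesis emb_inj : forall r, emb r = 0 -> r = 0.
Hypothesis phiC : forall c, phi c%:MP = emb c%:MP.
Hypothesis phiP : phi P = 0.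
Hypothesis u_reg : regular_mod u P.

(** Up to a power of [u], [h] reduces modulo [P] to a polynomial [r] that represents its value
    through the injective [emb]. The power allows for a substituted value such as [q ^- n], which is
    not a polynomial. *)
Definition clearable h :=
  exists e r, rdvd P (u ^+ e * h - r) /\ emb r = emb u ^+ e * phi h.

Hypothesis clearable_var : forall i, clearable 'X_i.

Lemma clearableC c : clearable c%:MP.
Proof.
exists 0%N, c%:MP; rewrite !expr0 !mul1r subrr phiC; split=> //.
by exists 0; rewrite mulr0.
Qed.

Lemma clearableD h h' : clearable h -> clearable h' -> clearable (h + h').
Proof.
move=> [e [r [[x hx] er]]] [e' [r' [[x' hx'] er']]].
exists (e + e')%N, (u ^+ e' * r + u ^+ e * r'); split.
  exists (u ^+ e' * x + u ^+ e * x'); rewrite [RHS]mulrDr !(mulrCA P) -hx -hx' exprD !mulrBr.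
  by rewrite opprD addrACA; congr (_ + _); rewrite mulrDr !mulrA (mulrC (u ^+ e')).
by rewrite rmorphD !rmorphM !rmorphXn /= er er' rmorphD exprD; ring.
Qed.

Lemma clearableM h h' : clearable h -> clearable h' -> clearable (h * h').
Proof.
move=> [e [r [[x hx] er]]] [e' [r' [[x' hx'] er']]].
exists (e + e')%N, (r * r'); split.
  exists (x * (u ^+ e' * h') + r * x').
  rewrite [RHS]mulrDr (mulrA P x) -hx (mulrCA P r) -hx' mulrBl mulrBr addrA subrK exprD.
  by rewrite mulrACA.
by rewrite !rmorphM /= er er' exprD; ring.
Qed.

Lemma clearable_all h : clearable h.
Proof.
elim/mpolyind: h => [|c m p _ _ IH]; first by rewrite -mpolyC0; apply: clearableC.
apply: clearableD => //; rewrite -mul_mpolyC; apply: clearableM; first exact: clearableC.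
have c1 : clearable 1 by rewrite -mpolyC1; apply: clearableC.
rewrite mpolyXE_id; apply: (big_ind clearable) => // [x y|i _]; first exact: clearableM.
by elim: (m i) => [|e IHe]; rewrite ?expr0 // exprS; apply: clearableM.
Qed.

(** If [phi h = 0] then [r = 0] by injectivity of [emb], so [P] divides [u ^+ e * h], and the
    regular factors [u] are removed one by one. *)
Lemma ker_clearable h : phi h = 0 <-> rdvd P h.
Proof.
split=> [h0|[x ->]]; last by rewrite rmorphM phiP mul0r.
have [e [r [+ er]]] := clearable_all h.
move: er; rewrite h0 mulr0 => /emb_inj ->; rewrite subr0.
by elim: e => [|e IH]; rewrite ?expr0 ?mul1r // exprS -mulrA => /u_reg.
Qed.
End SubstitutionKernel.

(** * The three morphisms and their kernels *)

Section Specialisations.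
Variables (n : nat) (z : algC).
Hypotheses (n_gt1 : (1 < n)%N) (n_odd : odd n) (prim_z : n.-primitive_root z).

(** One target serves all three morphisms: [algC] supplies the root of unity, and fractions are
    taken for the sake of [q ^- n]. *)
Definition CPol := {mpoly algC[5]}.
Definition CFrac := {fraction CPol}.
Definition CtoF : {rmorphism CPol -> CFrac} := @FracField.tofrac CPol.

Definition iq : 'I_5 := inord 0.
Definition ia : 'I_5 := inord 1.

Definition emb : {rmorphism Pol -> CFrac} := CtoF \o map_mpoly (@ratr algC).

Definition xvar (i : 'I_5) : CFrac := CtoF 'X_i.

(* [None] sends [q] to a primitive [n]-th root of unity, [Some true] sends [a]
   to [q ^+ n], and [Some false] sends [a] to [q ^- n]. *)
Definition point (j : option bool) (i : 'I_5) : CFrac :=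
  match j with
  | None => if i == iq then CtoF z%:MP else xvar i
  | Some s => if i == ia then (if s then xvar iq ^+ n else xvar iq ^- n) else xvar i
  end.

Definition phi (j : option bool) : {rmorphism Pol -> CFrac} :=
  mmap (CtoF \o ratmC 5) (point j).

Lemma phiX j i : phi j 'X_i = point j i.
Proof. by rewrite /phi /= mmapX mmap1U. Qed.

Lemma phi_mpolyC j r : phi j r%:MP = emb r%:MP.
Proof. by rewrite /phi /emb /= mmapC map_mpolyC. Qed.

Lemma embX i : emb 'X_i = xvar i.
Proof. by rewrite /emb /= map_mpolyX. Qed.

Lemma emb_eq0 r : emb r = 0 -> r = 0.
Proof.
move=> /eqP; rewrite /emb /= tofrac_eq0 => /eqP r0; apply/mpolyP => m.
have := congr1 (mcoeff m) r0; rewrite mcoeff_map_mpoly !mcoeff0 => /eqP.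
by rewrite fmorph_eq0 => /eqP.
Qed.

Lemma phi_None h : phi None h = CtoF (root_subst iq z h).
Proof.
rewrite /phi /root_subst /= /mmap rmorph_sum; apply: eq_bigr => m _.
rewrite rmorphM /=; congr (_ * _); rewrite /mmap1 rmorph_prod; apply: eq_bigr => i _.
by rewrite rmorphXn /=; case: ifP.
Qed.

Lemma phi_Phi j : phi j (PhiQ n) = (map_poly (fun k : int => k%:~R) 'Phi_n).[point j iq].
Proof.
rewrite /PhiQ -horner_map phiX -map_poly_comp; congr (_.[_]).
by apply: eq_map_poly => k /=; rewrite rmorph_int.
Qed.

Lemma ker_None h : phi None h = 0 <-> rdvd (PhiQ n) h.
Proof.
split=> [/eqP|[x ->]].
  by rewrite phi_None tofrac_eq0 => /eqP e; exact: (ker_root_subst prim_z e).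
suff e : phi None (PhiQ n) = 0 by rewrite rmorphM e mul0r.
rewrite phi_Phi /= eqxx.
have -> : map_poly (fun k : int => k%:~R) 'Phi_n =
    map_poly (CtoF \o @mpolyC 5 algC) (map_poly (fun k : int => k%:~R : algC) 'Phi_n).
  rewrite -map_poly_comp; apply: eq_map_poly => k /=.
  by rewrite !rmorph_int.
rewrite (Cintr_Cyclotomic prim_z) -[CtoF _]/((CtoF \o @mpolyC 5 algC) z) horner_map.
have /eqP -> : root (cyclotomic z n) z by rewrite root_cyclotomic.
by rewrite rmorph0.
Qed.

Lemma iqa : (iq == ia) = false.
Proof. by apply/eqP => /(congr1 val); rewrite /= !inordK. Qed.

Lemma CtoF_neq0 (v : 'I_5 -> algC) (p : CPol) : p.@[v] != 0 -> CtoF p != 0.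
Proof. by rewrite tofrac_eq0; apply: contraNneq => ->; rewrite meval0. Qed.

Lemma xvar_neq0 i : xvar i != 0.
Proof. by apply: (@CtoF_neq0 (fun=> 1)); rewrite mevalXU oner_neq0. Qed.

(** The value [q ^+ n] of [a] is a polynomial, so the clearing element is [1]. *)
Lemma ker_true h : phi (Some true) h = 0 <-> rdvd (Xa - Xq ^+ n) h.
Proof.
apply: (@ker_clearable _ _ _ _ emb _ 1).
- exact: emb_eq0.
- exact: phi_mpolyC.
- by rewrite rmorphB rmorphXn /= !phiX /= eqxx iqa subrr.
- by move=> x; rewrite mul1r.
move=> i; have [->|ni] := eqVneq i ia.
  exists 0%N, (Xq ^+ n); rewrite !expr0 !mul1r; split; first by exists 1; rewrite mulr1.
  by rewrite rmorphXn (embX iq) phiX /= eqxx.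
exists 0%N, 'X_i; rewrite !expr0 !mul1r subrr; split; first by exists 0; rewrite mulr0.
by rewrite embX phiX /= (negPf ni).
Qed.

(** Powers of [q] must be cleared here, and [q] is invertible modulo [1 - a q ^+ n], with inverse
    [a q ^+ n.-1]. *)
Lemma ker_false h : phi (Some false) h = 0 <-> rdvd (1 - Xa * Xq ^+ n) h.
Proof.
have q0 := expf_neq0 n (xvar_neq0 iq).
apply: (@ker_clearable _ _ _ _ emb _ Xq).
- exact: emb_eq0.
- exact: phi_mpolyC.
- by rewrite rmorphB rmorph1 rmorphM rmorphXn /= !phiX /= eqxx iqa mulVf ?subrr.
(* The witness comes from [x = (1 - a q ^+ n) x + a q ^+ n.-1 (q x)] with
   [q x = (1 - a q ^+ n) y]. *)
- move=> x [y xy]; exists (Xa * Xq ^+ n.-1 * y + x).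
  rewrite mulrDr mulrCA -xy mulrBl mul1r -!mulrA (mulrA (Xq ^+ _)) -exprSr prednK; last exact: ltnW.
  by rewrite addrC subrK.
move=> i; have [->|ni] := eqVneq i ia.
  exists n, 1; split; last by rewrite rmorph1 (embX iq) phiX /= eqxx divff.
  by exists (-1); rewrite mulrN1 opprB mulrC.
exists 0%N, 'X_i; rewrite !expr0 !mul1r subrr; split; first by exists 0; rewrite mulr0.
by rewrite embX phiX /= (negPf ni).
Qed.

End Specialisations.

(** * The three specialisations *)

(** These conditions keep the denominators of both sides non-zero. The family [nd_qq] is bounded
    because at a primitive [n]-th root of unity its factor of index [n.-1] is
    [1 - q ^+ (2 * n) = 0]. *)
Record nondegenerate (F : fieldType) (n : nat) (q a b c d : F) : Prop := Nondegenerate {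
  nd_q : q != 0; nd_1q : 1 - q != 0;
  nd_a : a != 0; nd_b : b != 0; nd_c : c != 0; nd_d : d != 0;
  nd_qq : forall i, (i < n.-1)%N -> 1 - q ^+ 2 * q ^+ 2 ^+ i != 0;
  nd_qa : forall i, 1 - q ^+ 2 / a * q ^+ 2 ^+ i != 0;
  nd_aq : forall i, 1 - a * q ^+ 2 * q ^+ 2 ^+ i != 0;
  nd_bq : forall i, 1 - b * q ^+ 2 * q ^+ 2 ^+ i != 0;
  nd_qb : forall i, 1 - (q ^+ 2)^-1 / b * q ^+ 2 ^+ i != 0;
  nd_qc : forall i, 1 - q ^+ 2 / c * q ^+ 2 ^+ i != 0;
  nd_qd : forall i, 1 - q ^+ 2 / d * q ^+ 2 ^+ i != 0 }.

Section SpecialiseTerms.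
Variables (R : idomainType) (K : fieldType) (J : Type) (phi : J -> {rmorphism R -> K}).
Variable j0 : J.
Local Notation spec := (specialises phi).

Lemma specialises_poch x y p r k : spec x y -> spec p r ->
  spec (poch x p k) (fun j => poch (y j) (r j) k).
Proof.
move=> hx hp; apply: (@specialises_prod _ _ _ _ k (fun i => 1 - x * p ^+ i)
  (fun j i => 1 - y j * r j ^+ i)) => i _.
apply: (specialisesB j0); first exact: specialises1.
by apply: specialisesM => //; apply: specialisesX.
Qed.

Variables (n : nat) (q a b c d : {fraction R}) (q' a' b' c' d' : J -> K).
Hypotheses (hq : spec q q') (ha : spec a a') (hb : spec b b') (hc : spec c c') (hd : spec d d').
Hypothesis nd : forall j, nondegenerate n (q' j) (a' j) (b' j) (c' j) (d' j).

Let q0' j : q' j != 0. Proof. exact: nd_q (nd j). Qed.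
Let a0' j : a' j != 0. Proof. exact: nd_a (nd j). Qed.
Let b0' j : b' j != 0. Proof. exact: nd_b (nd j). Qed.
Let c0' j : c' j != 0. Proof. exact: nd_c (nd j). Qed.
Let d0' j : d' j != 0. Proof. exact: nd_d (nd j). Qed.
Let q20' j : q' j ^+ 2 != 0. Proof. exact: expf_neq0. Qed.
Let cd0' j : c' j * d' j != 0. Proof. exact: mulf_neq0. Qed.

Lemma specialises_neq0 x y : (forall j, y j != 0) -> spec x y -> x != 0.
Proof.
move=> y0 [N [D [hD -> hy]]]; have := y0 j0; rewrite hy mulf_eq0 negb_or => /andP[N0 _].
by rewrite mulf_neq0 ?invr_eq0 ?(tof_neq0 (hD j0)) ?(tof_neq0 N0).
Qed.

Let hq2 : spec (q ^+ 2) (fun j => q' j ^+ 2). Proof. exact: specialisesX. Qed.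
Let hqV : spec q^-1 (fun j => (q' j)^-1). Proof. exact: specialisesV. Qed.
Let h1q : spec (1 - q) (fun j => 1 - q' j).
Proof. by apply: (specialisesB j0) => //; apply: specialises1. Qed.

Lemma specialises_lhs_term k : (k < n)%N ->
  spec (lhs_term q a b c d k) (fun j => lhs_term (q' j) (a' j) (b' j) (c' j) (d' j) k).
Proof.
move=> kn; have q0 := specialises_neq0 q0' hq.
(* The exponent [4 * k - 1] is negative at [k = 0], so the integer power is turned into a quotient
   of natural powers. *)
rewrite /lhs_term exprz_subl1 //.
apply: (@specialises_ext _ _ _ _ _ (fun j => (1 - q' j ^+ (4 * k) / q' j) / (1 - q' j) *
    (poch (a' j / q' j) (q' j ^+ 2) k * poch ((q' j)^-1 / a' j) (q' j ^+ 2) k *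
     poch ((q' j)^-1 / b' j) (q' j ^+ 2) k * poch (c' j / q' j) (q' j ^+ 2) k *
     poch (d' j / q' j) (q' j ^+ 2) k * poch (q' j)^-1 (q' j ^+ 2) k) /
    (poch (q' j ^+ 2 / a' j) (q' j ^+ 2) k * poch (a' j * q' j ^+ 2) (q' j ^+ 2) k *
     poch (b' j * q' j ^+ 2) (q' j ^+ 2) k * poch (q' j ^+ 2 / c' j) (q' j ^+ 2) k *
     poch (q' j ^+ 2 / d' j) (q' j ^+ 2) k * poch (q' j ^+ 2) (q' j ^+ 2) k) *
    (b' j * q' j ^+ 7 / (c' j * d' j)) ^+ k)).
  by move=> j; rewrite exprz_subl1.
have D : forall j,
    poch (q' j ^+ 2 / a' j) (q' j ^+ 2) k * poch (a' j * q' j ^+ 2) (q' j ^+ 2) k *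
    poch (b' j * q' j ^+ 2) (q' j ^+ 2) k * poch (q' j ^+ 2 / c' j) (q' j ^+ 2) k *
    poch (q' j ^+ 2 / d' j) (q' j ^+ 2) k * poch (q' j ^+ 2) (q' j ^+ 2) k != 0.
  move=> j; case: (nd j) => *; rewrite !mulf_neq0 // poch_neq0 // => i ik.
  by apply: nd_qq (nd j) _ _; rewrite (leq_trans ik) // -ltnS prednK // (leq_ltn_trans _ kn).
apply: specialisesM; last first.
  apply: specialisesX; apply: specialises_div; first exact: cd0'.
    by apply: specialisesM => //; apply: specialisesX.
  exact: specialisesM.
apply: specialises_div; first exact: D.
  apply: specialisesM.
    apply: specialises_div => //; first by move=> j; apply: nd_1q (nd j).
    apply: (specialisesB j0); first exact: specialises1.
    by apply: specialises_div => //; apply: specialisesX.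
  do ?apply: specialisesM; apply: specialises_poch => //; exact: specialises_div.
do ?apply: specialisesM; apply: specialises_poch => //.
- exact: specialises_div.
- exact: specialisesM.
- exact: specialisesM.
- exact: specialises_div.
- exact: specialises_div.
Qed.

Lemma specialises_rhs_term k : (k < n)%N ->
  spec (rhs_term q a b c d k) (fun j => rhs_term (q' j) (a' j) (b' j) (c' j) (d' j) k).
Proof.
move=> kn; rewrite /rhs_term.
apply: specialisesM; last exact: specialisesX.
apply: specialises_div.
- move=> j; case: (nd j) => *; rewrite !mulf_neq0 // poch_neq0 // => i ik.
  by apply: nd_qq (nd j) _ _; rewrite (leq_trans ik) // -ltnS prednK // (leq_ltn_trans _ kn).
- do ?apply: specialisesM; apply: specialises_poch => //; apply: specialises_div => //.
    exact: specialisesX.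
  exact: specialisesM.
do ?apply: specialisesM; apply: specialises_poch => //; apply: specialises_div => //.
exact: specialisesV.
Qed.

Lemma specialises_rhs_factor m :
  spec (rhs_factor q b n m) (fun j => rhs_factor (q' j) (b' j) n m).
Proof.
rewrite /rhs_factor; apply: specialises_div.
- by move=> j; case: (nd j) => *; rewrite poch_neq0.
- apply: specialisesM.
    apply: specialisesM; last by apply: specialisesX; apply: specialisesM.
    apply: specialises_div => //; first by move=> j; apply: nd_1q (nd j).
    apply: (specialisesB j0); first exact: specialises1.
    exact: specialisesX.
  by apply: specialises_poch => //; apply: specialises_div => //; apply: specialisesV.
by apply: specialises_poch => //; apply: specialisesM.
Qed.

End SpecialiseTerms.

Lemma sum_ord_trunc (V : nmodType) (t : nat -> V) m M : (m <= M)%N ->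
  (forall k, (m < k)%N -> t k = 0) -> \sum_(k < M.+1) t k = \sum_(k < m.+1) t k.
Proof.
move=> mM t0; rewrite (big_ord_widen _ t (mM : (m.+1 <= M.+1)%N)).
rewrite (bigID (fun k : 'I_M.+1 => (k < m.+1)%N)) /= [X in _ + X]big1 ?addr0 // => k.
by rewrite -leqNgt => /t0.
Qed.

(** * From the three evaluations to the congruence *)

Section Congruence.
Variables (R : idomainType) (K : fieldType) (phi : option bool -> {rmorphism R -> K}).
Variables (P : option bool -> R).
Hypothesis kerP : forall j h, phi j h = 0 <-> rdvd (P j) h.
Hypothesis P_neq0 : forall j, P j != 0.
Hypothesis PhiP : forall s, phi (Some s) (P None) != 0.
Hypothesis PtP : phi (Some true) (P (Some false)) != 0.

(** [N] is killed by all three morphisms. The factors of the modulus are split off in turn, since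
    those already removed do not vanish at the next point. The denominator is regular modulo each
    factor, hence modulo [Q], and shares only units with it. *)
Lemma specialises0_congr x : specialises phi x (fun=> 0) ->
  let Q := P None * P (Some false) * P (Some true) in
  exists N D, [/\ D != 0, forall g, rdvd g D -> rdvd g Q -> g \is a GRing.unit &
    x = @FracField.tofrac R (N * Q) / @FracField.tofrac R D].
Proof.
move=> [N [D [hD -> hy]]] Q.
have N0 j : phi j N = 0.
  by have /eqP := hy j; rewrite eq_sym mulf_eq0 invr_eq0 (negPf (hD j)) orbF => /eqP.
have [N1 e1] : rdvd (P None) N by apply/kerP.
have [N2 e2] : rdvd (P (Some false)) N1.
  by apply: (rdvd_kerM (kerP (Some false)) (PhiP _)); rewrite -e1.
have [N3 e3] : rdvd (P (Some true)) N2.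
  apply: (rdvd_kerM (kerP (Some true)) (g := P None * P (Some false))).
    by rewrite rmorphM mulf_neq0.
  by rewrite -mulrA -e2 -e1.
exists N3, D; split.
- by have := hD None; apply: contraNneq => ->; rewrite rmorph0.
- move=> g; apply: regular_mod_unit; first by rewrite /Q !mulf_neq0.
  apply: regular_modM; rewrite ?mulf_neq0 //; last exact: (regular_mod_ker (kerP _)).
  by apply: regular_modM; rewrite ?mulf_neq0 //; apply: (regular_mod_ker (kerP _)).
by congr (tofrac _ / _); rewrite e1 e2 e3 [RHS]mulrC /Q !mulrA.
Qed.
End Congruence.

Lemma one_sub_div_neq0 (F : fieldType) (u v w : F) :
  v != 0 -> v - u * w != 0 -> 1 - u / v * w != 0.
Proof.
move=> v0 h; have -> : 1 - u / v * w = (v - u * w) / v by field.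
by rewrite mulf_neq0 ?invr_eq0.
Qed.

Lemma one_sub_divV_neq0 (F : fieldType) (u v w : F) :
  u != 0 -> v != 0 -> v * u - w != 0 -> 1 - u^-1 / v * w != 0.
Proof.
move=> u0 v0 h; have -> : 1 - u^-1 / v * w = (v * u - w) / (v * u) by field_nz.
by rewrite mulf_neq0 ?invr_eq0 ?mulf_neq0.
Qed.

(** * Non-vanishing of the denominators at the three points *)

Section Points.
Variables (n : nat) (z : algC).
Hypotheses (n_gt1 : (1 < n)%N) (n_odd : odd n) (prim_z : n.-primitive_root z).
Local Notation pt := (point n z).

(** A test point for non-vanishing: the free variables become zero while the image of [q] keeps a
    non-zero value. *)
Definition pt0 (i : 'I_5) : algC := (i == iq)%:R.

Lemma z_neq0 : z != 0.
Proof.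
apply: contraTneq (oner_neq0 algC) => z0.
by rewrite -(prim_expr_order prim_z) z0 expr0n gtn_eqF ?eqxx // ltnW.
Qed.

Lemma point_iq j : exists2 s : CPol, pt j iq = CtoF s & s.@[pt0] != 0.
Proof.
case: j => [b|] /=.
  by rewrite iqa; exists 'X_iq => //; rewrite mevalXU /pt0 eqxx oner_neq0.
by rewrite eqxx; exists z%:MP => //; rewrite mevalC z_neq0.
Qed.

Lemma point_iq_neq0 j : pt j iq != 0.
Proof. by have [s -> s0] := point_iq j; apply: CtoF_neq0 s0. Qed.

Section FreeVariable.
Variables (i : 'I_5) (j : option bool).
Hypothesis i_q : i != iq.
Let meval_i : ('X_i : CPol).@[pt0] = 0.
Proof. by rewrite mevalXU /pt0 (negPf i_q). Qed.

Lemma xvar_mul_neq1 k : 1 - xvar i * pt j iq ^+ 2 * pt j iq ^+ 2 ^+ k != 0.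
Proof.
have [s -> _] := point_iq j; rewrite /xvar -!rmorphXn -!rmorphM -(rmorph1 CtoF) -rmorphB.
by apply: (@CtoF_neq0 pt0); rewrite mevalB !mevalM meval_i !mul0r meval1 subr0 oner_neq0.
Qed.

Lemma div_xvar_neq1 k : 1 - pt j iq ^+ 2 / xvar i * pt j iq ^+ 2 ^+ k != 0.
Proof.
apply: one_sub_div_neq0; first exact: xvar_neq0.
have [s -> s0] := point_iq j; rewrite /xvar -!rmorphXn -!rmorphM -rmorphB.
apply: (@CtoF_neq0 pt0); rewrite mevalB mevalM meval_i !rmorphXn /= sub0r oppr_eq0.
by rewrite mulf_neq0 ?expf_neq0.
Qed.

Lemma inv_xvar_neq1 k : 1 - (pt j iq ^+ 2)^-1 / xvar i * pt j iq ^+ 2 ^+ k != 0.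
Proof.
apply: one_sub_divV_neq0; [exact/expf_neq0/point_iq_neq0 | exact: xvar_neq0 |].
have [s -> s0] := point_iq j; rewrite /xvar -!rmorphXn -!rmorphM -rmorphB.
apply: (@CtoF_neq0 pt0); rewrite mevalB mevalM meval_i !rmorphXn /= mul0r sub0r oppr_eq0.
by rewrite !expf_neq0.
Qed.
End FreeVariable.

Lemma xvar_expI i : injective (fun k => xvar i ^+ k).
Proof.
move=> k l /= /eqP; rewrite /xvar -!rmorphXn /= tofrac_eq => /eqP.
rewrite !mpolyXn => /(congr1 (mcoeff (U_(i) *+ k)%MM)); rewrite !mcoeffX eqxx.
case: eqP => [/(congr1 (fun m : 'X_{1.. 5} => m i))|_ /eqP]; last by rewrite oner_eq0.
by rewrite !mulmnE !mnm1E eqxx !mul1n.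
Qed.

Lemma xvar_exp_neq1 i k : 1 - xvar i ^+ k.+1 != 0.
Proof.
rewrite subr_eq0; apply/eqP; rewrite -[1](expr0 (xvar i)).
by move=> /(@xvar_expI i).
Qed.

Let odd_neq k : (n == 2 + 2 * k)%N = false.
Proof. by apply/eqP => e; move: n_odd; rewrite e oddD oddM. Qed.

(** Parity decides: the even exponent [2 + 2 * k] never equals the odd [n]. *)
Lemma qpow_div_neq1 k : 1 - xvar iq ^+ 2 / xvar iq ^+ n * xvar iq ^+ 2 ^+ k != 0.
Proof.
rewrite mulrAC -exprM -exprD subr_eq0; apply/eqP => /(congr1 (fun x => x * xvar iq ^+ n)).
rewrite mul1r divfK ?expf_neq0 ?xvar_neq0 // => /(@xvar_expI iq) /eqP.
by rewrite odd_neq.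
Qed.

Lemma qpow_mul_neq1 k : 1 - xvar iq ^+ n * xvar iq ^+ 2 * xvar iq ^+ 2 ^+ k != 0.
Proof. by rewrite -exprM -!exprD -addnA addnC !addSn xvar_exp_neq1. Qed.

Lemma point_nondegenerate j (ib ic id : 'I_5) :
  ib != iq -> ic != iq -> id != iq ->
  nondegenerate n (pt j iq) (pt j ia) (xvar ib) (xvar ic) (xvar id).
Proof.
move=> bq cq dq; have iaq : ia != iq by rewrite eq_sym iqa.
have q0 := point_iq_neq0 j; have x0 := xvar_neq0.
apply: Nondegenerate.
- exact: q0.
- case: j {q0} => [s|] /=; first by rewrite iqa -[xvar iq]expr1 xvar_exp_neq1.
  rewrite eqxx -(rmorph1 CtoF) -rmorphB; apply: (@CtoF_neq0 pt0).
  rewrite mevalB meval1 mevalC subr_eq0 eq_sym -[z]expr1 -(prim_order_dvd prim_z).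
  by rewrite dvdn1 gtn_eqF.
- case: j {q0} => [[]|] /=; rewrite ?eqxx ?(negPf iaq) ?invr_eq0 ?expf_neq0 //.
- exact: x0.
- exact: x0.
- exact: x0.
- move=> i i_n; rewrite -exprS -exprM.
  case: j {q0} => [s|] /=; first by rewrite iqa mulnS xvar_exp_neq1.
  rewrite eqxx -(rmorph1 CtoF) -rmorphXn -rmorphB; apply: (@CtoF_neq0 pt0).
  rewrite mevalB meval1 rmorphXn /= mevalC subr_eq0 eq_sym -(prim_order_dvd prim_z).
  (* As [n] is odd, it divides [2 * i.+1] only if it divides [i.+1], which is smaller than [n]. *)
  rewrite Gauss_dvdr ?coprimen2 // gtnNdvd //.
  by rewrite -(prednK (ltnW n_gt1)) ltnS.
- case: j {q0} => [[]|] i /=; rewrite ?eqxx ?iqa.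
  + exact: qpow_div_neq1.
  + by rewrite invrK (mulrC _ (xvar iq ^+ n)) qpow_mul_neq1.
  + by have := @div_xvar_neq1 ia None iaq i; rewrite /= eqxx (negPf iaq).
- case: j {q0} => [[]|] i /=; rewrite ?eqxx ?iqa.
  + exact: qpow_mul_neq1.
  + by rewrite (mulrC _ (xvar iq ^+ 2)) qpow_div_neq1.
  + by have := @xvar_mul_neq1 ia None iaq i; rewrite /= eqxx (negPf iaq).
- by move=> i; apply: xvar_mul_neq1.
- by move=> i; apply: inv_xvar_neq1.
- by move=> i; apply: div_xvar_neq1.
- by move=> i; apply: div_xvar_neq1.
Qed.

End Points.

(** * Agreement of the two sides at each point *)

Section Evaluation.
Variables (F : fieldType) (n m M : nat) (q a b c d : F).
Hypotheses (n_gt1 : (1 < n)%N) (nm : n.+1 = (2 * m)%N) (mM : (m <= M)%N).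
Hypothesis nd : nondegenerate n q a b c d.
Local Notation sides_agree a := (\sum_(k < M.+1) lhs_term q a b c d k =
  rhs_factor q b n m * \sum_(k < m.+1) rhs_term q a b c d k).

Let qm : q ^+ 2 ^+ m = q ^+ n * q.
Proof. by rewrite -exprM -nm exprSr. Qed.

Lemma sides_agree_root : q ^+ n = 1 -> 2%:R != 0 :> F -> sides_agree a.
Proof.
move=> qn two0; have qm1 : q ^+ 2 ^+ m = q by rewrite qm qn mul1r.
have [q0 q1 a0 b0 c0 d0 hqq hqa haq hbq hqb hqc hqd] := nd.
have mn : (m <= n.-1)%N.
  rewrite -ltnS prednK ?(ltnW n_gt1) // -(ltn_pmul2l (ltn0Sn 1)) -nm mul2n -addnn.
  by rewrite -addn1 ltn_add2l.
rewrite /rhs_factor -exprnP qn subrr !mul0r (sum_ord_trunc mM) => [|k mk].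
  by apply: (lhs_sum_eq0 q0 b0 c0 d0 qm1) => // i im; apply: hqq; apply: leq_trans im mn.
(* Beyond [m], the shifted factorial of [q^-1] contains the factor [1 - q^-1 * q] of index [m]. *)
by apply: (lhs_term_eq0 _ _ _ mk); rewrite qm1 mulVf // subrr eqxx !orbT.
Qed.

Hypothesis qtr : forall i, 1 - q ^+ i.+1 != 0.

Lemma sides_agree_pow s : a = (if s then q ^+ n else q ^- n) -> sides_agree a.
Proof.
have [q0 q1 a0 b0 c0 d0 hqq hqa haq hbq hqb hqc hqd] := nd.
have qn0 : q ^+ n != 0 by rewrite expf_neq0.
move=> aE; rewrite (sum_ord_trunc mM) => [|k mk]; last first.
  (* The factor of index [m] vanishes: that of [q^-1 / a] when [a = q ^+ n], that of [a / q] when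
     [a = q ^- n]. *)
  apply: (lhs_term_eq0 _ _ _ mk); rewrite qm aE; apply/or3P; case: (s).
    by apply: Or32; rewrite subr_eq0; apply/eqP; field_nz.
  by apply: Or31; rewrite subr_eq0; apply/eqP; field_nz.
have {}aE : (if s then a^-1 else a) = q / q ^+ 2 ^+ m.
  by rewrite qm invfM mulrCA divff // mulr1 aE; case: (s).
case: s aE => aE; last exact: (watson_specialised q0 b0 c0 d0 aE).
under eq_bigr do rewrite -lhs_termV.
under [in RHS]eq_bigr do rewrite -rhs_termV.
apply: (watson_specialised q0 b0 c0 d0 aE) => // i.
by rewrite (mulrC a^-1).
Qed.
End Evaluation.

(** * Assembly of the congruence *)

Lemma invr_fixed (F : fieldType) (x : F) : x != 0 -> x^-1 = x -> x * x = 1.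
Proof. by move=> x0 {2}<-; rewrite divff. Qed.

(** [mcoprime] asks for non-zero constants, whereas regularity produces units. *)
Lemma mpoly_unit_const (k : fieldType) (N : nat) (g : {mpoly k[N]}) :
  g \is a GRing.unit -> exists r : k, r != 0 /\ g = r%:MP.
Proof. by case/andP=> /eqP e; rewrite unitfE => r0; exists g@_0. Qed.

(** [Phi_n] divides ['X^n - 1] over the integers, and this factorisation is transported to [R]. *)
Lemma Cyclotomic_root (R : comNzRingType) (n : nat) (x : R) : (0 < n)%N ->
  (map_poly (fun k : int => k%:~R) 'Phi_n).[x] = 0 -> x ^+ n = 1.
Proof.
move=> n0 h; apply/eqP; rewrite -subr_eq0.
have -> : x ^+ n - 1 = (map_poly (fun k : int => k%:~R) ('X^n - 1)).[x].
  by rewrite rmorphB rmorph1 /= map_polyXn !hornerE.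
rewrite -(prod_Cyclotomic n0) (bigD1_seq n) ?divisors_uniq -?dvdn_divisors //=.
by rewrite rmorphM hornerM h mul0r.
Qed.

Theorem theorem1p1 (n M : nat) :
  odd n -> (1 < n)%N -> (M = ((n + 1) %/ 2)%N \/ M = (n - 1)%N) ->
  congr_mod (lhs M) (rhs n) (modulus n).
Proof.
move=> n_odd n_gt1 hM; have n_gt0 := ltnW n_gt1.
have [z prim_z] := C_prim_root_exists n_gt0.
pose m := ((n + 1) %/ 2)%N.
have nm : n.+1 = (2 * m)%N by rewrite mulnC /m divnK ?addn1 // dvdn2 /= n_odd.
have mn : (m < n)%N.
  by rewrite -(ltn_pmul2l (ltn0Sn 1)) -nm mul2n -addnn -addn1 ltn_add2l.
(* Both choices of [M] enter only through these bounds: the sum reaches the index [m] where it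
   stops, and the denominators survive at the root of unity. *)
have [mM Mn] : (m <= M)%N /\ (M < n)%N.
  case: hM => ->; first by rewrite leqnn.
  by rewrite subn1 -ltnS prednK.
have iN k : (0 < k < 5)%N -> (inord k : 'I_5) != iq.
  case/andP=> k0 k5; apply: contraTneq k0 => /(congr1 val).
  by rewrite /= !inordK // => ->.
have nd j := point_nondegenerate n_gt1 n_odd prim_z j (iN 2%N isT) (iN 3%N isT) (iN 4%N isT).
have spec_var i : specialises (phi n z) (tof 'X_i) (fun j => point n z j i).
  by apply: specialises_ext (specialises_tof (phi n z) 'X_i) => j; rewrite phiX.
have spec_free k : (1 < k < 5)%N ->
    specialises (phi n z) (tof 'X_(inord k)) (fun=> xvar (inord k)).
  case/andP=> k1 k5; apply: specialises_ext (spec_var _) => -[s|] /=.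
    by case: eqP => // /(congr1 val); rewrite /= !inordK // => e; rewrite e in k1.
  by rewrite (negPf (iN _ _)) // (ltnW k1).
have spec_diff : specialises (phi n z) (lhs M - rhs n) (fun=> 0).
  have -> : lhs M = \sum_(k < M.+1) lhs_term q a b c d k by rewrite /lhs big_mkord.
  have -> : rhs n = rhs_factor q b n m * \sum_(k < m.+1) rhs_term q a b c d k.
    by rewrite /rhs big_mkord.
  (* The value of the difference is assembled term by term first, and only then compared with zero
     at each point. *)
  apply: specialises_ext; last first.
    apply: (specialisesB None).
      apply: (specialises_sum None) => k kM.
      by apply: (specialises_lhs_term None (spec_var iq) (spec_var ia)
        (spec_free 2%N isT) (spec_free 3%N isT) (spec_free 4%N isT) nd); apply: leq_trans kM Mn.
    apply: specialisesM.
      exact: (specialises_rhs_factor None (spec_var iq) (spec_free 2%N isT) nd).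
    apply: (specialises_sum None) => k km.
    by apply: (specialises_rhs_term None (spec_var iq) (spec_var ia)
        (spec_free 2%N isT) (spec_free 3%N isT) (spec_free 4%N isT) nd); apply: leq_trans km mn.
  move=> j /=; apply/eqP; rewrite subr_eq0; apply/eqP.
  case: j => [s|].
    have qtr i : 1 - point n z (Some s) iq ^+ i.+1 != 0 by rewrite /= iqa xvar_exp_neq1.
    by apply: (sides_agree_pow nm mM (nd (Some s)) qtr (s := s)); rewrite /= iqa eqxx.
  apply: (sides_agree_root n_gt1 nm mM (nd None)).
    by rewrite /= eqxx -!rmorphXn /= (prim_expr_order prim_z) !rmorph1.
  rewrite -(rmorph_nat CtoF); apply: (@CtoF_neq0 (fun=> 0)).
  by rewrite rmorph_nat pnatr_eq0.
pose P (j : option bool) : Pol :=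
  match j with
  | None => PhiQ n
  | Some false => 1 - Xa * Xq ^+ n
  | Some true => Xa - Xq ^+ n
  end.
have kerP j h : phi n z j h = 0 <-> rdvd (P j) h.
  by case: j => [[]|]; [exact: ker_true | exact: ker_false | exact: ker_None].
have nz_phi j (p : Pol) : phi n z j p != 0 -> p != 0.
  by apply: contraNneq => ->; rewrite rmorph0.
have qn_neq1 k : xvar iq ^+ n * xvar iq ^+ k != 1.
  by rewrite -exprD -(prednK n_gt0) addSn eq_sym -subr_eq0 xvar_exp_neq1.
(* The image of [q] is an indeterminate here, while a root of [Phi_n] would satisfy [q ^+ n = 1]. *)
have Phi_neq0 s : phi n z (Some s) (P None) != 0.
  rewrite phi_Phi /= iqa; apply/eqP => /(Cyclotomic_root n_gt0) /eqP.
  by have := qn_neq1 0%N; rewrite mulr1 => /negPf ->.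
have Pf_neq0 : phi n z (Some true) (P (Some false)) != 0.
  rewrite rmorphB rmorph1 rmorphM rmorphXn !phiX /= eqxx iqa subr_eq0 eq_sym.
  exact: qn_neq1.
(* At [a = q ^- n], vanishing would mean [q ^- n = q ^+ n], hence [q ^+ (2 * n) = 1]. *)
have Pt_neq0 : phi n z (Some false) (P (Some true)) != 0.
  rewrite rmorphB rmorphXn !phiX /= eqxx iqa subr_eq0; apply/eqP => e.
  have /eqP := invr_fixed (expf_neq0 n (xvar_neq0 iq)) e.
  exact/negP/(qn_neq1 n).
have P_neq0 j : P j != 0 by case: j => [[]|]; [exact: nz_phi Pt_neq0 | exact: nz_phi Pf_neq0
  | exact: nz_phi (Phi_neq0 true)].
have [N [D [D0 cop e]]] := specialises0_congr kerP P_neq0 Phi_neq0 Pf_neq0 spec_diff.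
exists N, D; split=> //; split; last exact: e.
by move=> g gD gP; apply: mpoly_unit_const; apply: cop.
Qed.
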